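(* Let $\Lambda$ be a CM-finite Artinian algebra. Then $\Lambda$ satisfies the Gorenstein projective conjecture; that is, for every Gorenstein projective $\Lambda$-module $M$, $M$ is projective if and only if ${\rm Ext}_{\Lambda}^{i}(M,M)=0$ for all $i\geq 1$.
   Context: An Artinian algebra (Artin algebra) is an algebra that is finitely generated as a module over a commutative Artinian ring. All modules are finitely generated left modules. A right $\Lambda$-module is a left module over the opposite algebra $\Lambda^{o}$. A $\Lambda$-module $M$ is called Gorenstein projective if ${\rm Ext}_{\Lambda}^{i}(M,\Lambda)=0$ and ${\rm Ext}_{\Lambda^{o}}^{i}({\rm Tr}\,M,\Lambda)=0$ for all $i\geq 1$, where ${\rm Tr}\,M$ is the Auslander transpose of $M$ (a right $\Lambda$-module): if $P_1\to P_0\to M\to 0$ is a minimal projective presentation, then ${\rm Tr}\,M$ is the cokernel of ${\rm Hom}_\Lambda(P_0,\Lambda)\to{\rm Hom}_\Lambda(P_1,\Lambda)$. $\Lambda$ is called CM-finite (of finite Cohen-Macaulay type) if there are only finitely many isomorphism classes of indecomposable (finitely generated) Gorenstein projective $\Lambda$-modules. *)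

(* Defs.v *)
From HB Require Import structures.
From mathcomp Require Import all_boot all_order all_algebra.
From mathcomp Require Import boolp classical_sets.

Set Implicit Arguments.
Unset Strict Implicit.
Unset Printing Implicit Defensive.

Import GRing.Theory.
Local Open Scope ring_scope.

(* A left module over L is an [lmodType L]; a right module over L is a left    *)
(* module over the converse (opposite) ring, i.e. an [lmodType L^c]. The left  *)
(* regular module is L^o and the right regular one is (L^c)^o.                 *)

Definition is_ideal (R : comNzRingType) (I : set R) : Prop :=
  [/\ I 0, (forall x y, I x -> I y -> I (x + y))
    & (forall a x, I x -> I (a * x))].

Definition artinian (R : comNzRingType) : Prop :=
  forall I : nat -> set R,
    (forall n, is_ideal (I n)) -> (forall n, (I n.+1 `<=` I n)%classic) ->
    exists N : nat, forall n, (N <= n)%N -> I n = I N.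

Definition fin_gen (R : pzRingType) (M : lmodType R) : Prop :=
  exists (n : nat) (e : 'I_n -> M),
    forall x : M, exists c : 'I_n -> R, x = \sum_(i < n) c i *: e i.

Definition artin_algebra (R : comNzRingType) (L : algType R) : Prop :=
  artinian R /\ fin_gen L.

Section Modules.
Variable L : pzRingType.
Implicit Types M N P : lmodType L.

Definition surj (A B : Type) (f : A -> B) : Prop := forall y, exists x, f x = y.

Definition isomorphic M N : Prop := exists f : {linear M -> N}, bijective f.

Definition zero_module M : Prop := forall x : M, x = 0.

Definition indecomposable M : Prop :=
  ~ zero_module M /\
  forall A B : lmodType L,
    isomorphic M (A * B)%type -> zero_module A \/ zero_module B.

Definition projective P : Prop :=
  forall (U V : lmodType L) (g : {linear U -> V}) (f : {linear P -> V}),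
    surj g -> exists h : {linear P -> U}, forall x, g (h x) = f x.

(* Exactness of A -> B -> C at B. *)
Definition exact_at (A B C : lmodType L) (f : A -> B) (g : B -> C) : Prop :=
  forall y, g y = 0 <-> exists x, f x = y.

Record proj_resolution M := ProjResolution {
  res_mod :> nat -> lmodType L;
  res_diff : forall n, {linear res_mod n.+1 -> res_mod n};
  res_aug : {linear res_mod 0%N -> M};
  res_projective : forall n, projective (res_mod n);
  res_aug_surj : surj res_aug;
  res_exact0 : exact_at (res_diff 0%N) res_aug;
  res_exact : forall n, exact_at (res_diff n.+1) (res_diff n)
}.

Section Cohomology.
Variables (M N : lmodType L) (P : proj_resolution M).

Definition cocycle n (f : {linear P n -> N}) : Prop :=
  forall x, f (res_diff P n x) = 0.

Definition coboundary n : {linear P n -> N} -> Prop :=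
  match n with
  | 0%N => fun f => forall x, f x = 0
  | m.+1 => fun f =>
      exists g : {linear P m -> N}, forall x, f x = g (res_diff P m x)
  end.

End Cohomology.

(* Ext^n_L(M, N) = 0: the n-th cohomology of Hom_L(P, N) vanishes, where P is  *)
(* a projective resolution of M. The choice of P is immaterial.                *)
Definition Ext_vanish (n : nat) M N : Prop :=
  exists P : proj_resolution M,
    forall f : {linear P n -> N}, cocycle f -> coboundary f.

(* f is an essential epimorphism onto its image, i.e. ker f is superfluous.    *)
Definition essential_onto_image (A B : lmodType L) (f : {linear A -> B}) :
    Prop :=
  forall (X : lmodType L) (g : {linear X -> A}),
    (forall a, exists x, f (g x) = f a) -> surj g.

(* P1 -d-> P0 -e-> M -> 0 is exact, P0 -> M and P1 -> Ker e are projective     *)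
(* covers.                                                                     *)
Definition min_proj_presentation (P1 P0 M : lmodType L)
    (d : {linear P1 -> P0}) (e : {linear P0 -> M}) : Prop :=
  [/\ projective P1 /\ projective P0, surj e, exact_at d e,
      essential_onto_image e & essential_onto_image d].

End Modules.

(* Hom_L(P, L) as a right L-module: (f a) x = (f x) a.                         *)
Definition dual (L : pzRingType) (P : lmodType L) : Type := {linear P -> L^o}.

Section Dual.
Variables (L : pzRingType) (P : lmodType L).
Implicit Types f g h : dual P.

Definition dual_fun f : P -> L := (f : {linear P -> L^o}).
Coercion dual_fun : dual >-> Funclass.

Lemma dual_ext f g : (forall x, f x = g x) -> f = g.
Proof.
move=> /funext; rewrite /dual_fun; case: f g => [f cf] [g cg] /= E.
move: cf cg; rewrite E => -[[s1] [z1]] [[s2] [z2]].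
by rewrite (Prop_irrelevance s1 s2) (Prop_irrelevance z1 z2).
Qed.

HB.instance Definition _ := gen_eqMixin (dual P).
HB.instance Definition _ := gen_choiceMixin (dual P).

Lemma dual_scale_linear (a : L^c) f :
  linear (fun x => (f x * (a : L) : L^o)).
Proof.
move=> b x y; rewrite /dual_fun linearP /=.
by rewrite -[b *: (_ : L^o)]/(b * _) mulrDl -mulrA.
Qed.

Definition dual_zero : dual P := (\0 : {linear P -> L^o}).
Definition dual_opp f : dual P :=
  (GRing.opp_fun (f : {linear P -> L^o}) : {linear P -> L^o}).
Definition dual_add f g : dual P :=
  ((f : {linear P -> L^o}) \+ (g : {linear P -> L^o}) : {linear P -> L^o}).
Definition dual_scale (a : L^c) f : dual P :=
  HB.pack_for {linear P -> L^o} (fun x => (f x * (a : L) : L^o))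
    (GRing.isLinear.Build _ _ _ _ _ (dual_scale_linear a f)).

Lemma dual_addA : associative dual_add.
Proof. by move=> f g h; apply: dual_ext => x; exact: addrA. Qed.

Lemma dual_addC : commutative dual_add.
Proof. by move=> f g; apply: dual_ext => x; exact: addrC. Qed.

Lemma dual_add0 : left_id dual_zero dual_add.
Proof. by move=> f; apply: dual_ext => x; exact: add0r. Qed.

Lemma dual_addN : left_inverse dual_zero dual_opp dual_add.
Proof. by move=> f; apply: dual_ext => x; exact: addNr. Qed.

HB.instance Definition _ :=
  GRing.isZmodule.Build (dual P) dual_addA dual_addC dual_add0 dual_addN.

Lemma dual_scaleA (a b : L^c) f :
  dual_scale a (dual_scale b f) = dual_scale (a * b) f.
Proof. by apply: dual_ext => x; exact/esym/(@mulrA L). Qed.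

Lemma dual_scale1 : left_id 1 dual_scale.
Proof. by move=> f; apply: dual_ext => x; exact: (@mulr1 L). Qed.

Lemma dual_scaleDr : right_distributive dual_scale +%R.
Proof. by move=> a f g; apply: dual_ext => x; exact: (@mulrDl L). Qed.

Lemma dual_scaleDl f : {morph dual_scale^~ f : a b / a + b}.
Proof. by move=> a b; apply: dual_ext => x; exact: (@mulrDr L). Qed.

HB.instance Definition _ :=
  GRing.Zmodule_isLmodule.Build L^c (dual P)
    dual_scaleA dual_scale1 dual_scaleDr dual_scaleDl.

Lemma dual_addE f g x : (f + g) x = f x + g x. Proof. by []. Qed.

Lemma dual_scaleE (a : L^c) f x : (a *: f) x = f x * (a : L).
Proof. by []. Qed.

End Dual.

Section Transpose.
Variable L : pzRingType.

(* Hom_L(d, L), i.e. precomposition with d. *)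
Definition dual_map (P1 P0 : lmodType L) (d : {linear P1 -> P0})
    (f : dual P0) : dual P1 :=
  ((f : {linear P0 -> L^o}) \o d : {linear P1 -> L^o}).

Lemma dual_mapE (P1 P0 : lmodType L) (d : {linear P1 -> P0}) (f : dual P0) x :
  dual_map d f x = f (d x).
Proof. by []. Qed.

(* The right module T is a transpose of M: it is a cokernel of                 *)
(* Hom_L(P0, L) -> Hom_L(P1, L) for some minimal projective presentation       *)
(* P1 -> P0 -> M -> 0.                                                         *)
Definition is_transpose (M : lmodType L) (T : lmodType L^c) : Prop :=
  exists (P1 P0 : lmodType L) (d : {linear P1 -> P0}) (e : {linear P0 -> M})
         (q : {linear dual P1 -> T}),
    [/\ min_proj_presentation d e, surj q & exact_at (dual_map d) q].

(* Tr M exists and is unique up to isomorphism when M is finitely generated    *)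
(* over an Artin algebra.                                                      *)
Definition gorenstein_projective (M : lmodType L) : Prop :=
  (forall i : nat, (1 <= i)%N -> Ext_vanish i M L^o) /\
  (exists2 T : lmodType L^c, is_transpose M T &
     forall i : nat, (1 <= i)%N -> Ext_vanish i T (L^c)^o).

(* Every finitely generated indecomposable Gorenstein projective module is     *)
(* isomorphic to a member of some finite list; other members are harmless.     *)
Definition CM_finite : Prop :=
  exists (n : nat) (G : 'I_n -> lmodType L),
    forall M : lmodType L,
      fin_gen M -> indecomposable M -> gorenstein_projective M ->
      exists i, isomorphic M (G i).

End Transpose.

(* Main.v *)
Require Import Defs.
From HB Require Import structures.
From mathcomp Require Import all_boot all_order all_algebra.
From mathcomp Require Import boolp classical_sets.

Set Implicit Arguments.
Unset Strict Implicit.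
Unset Printing Implicit Defensive.

Import GRing.Theory.
Local Open Scope ring_scope.

(** M is Gorenstein projective iff it is totally reflexive: M -> M^** is
    bijective and Ext^i(M, L) = Ext^i(M^*, L) = 0 for all i >= 1 (M^* is a
    second syzygy of Tr M). In this form the notion visibly passes to direct
    summands and to syzygies.

    Let M_0 = M and let M_(n+1) be a syzygy of M_n. If M is Gorenstein
    projective with Ext^i(M, M) = 0 for all i >= 1, then dimension shifting gives
    Ext^i(M_n, M_m) = 0 for all m <= n and i >= 1. As L is CM-finite, two of the
    M_n, say M_m and M_(n+1) with m <= n, have the same indecomposable summands
    up to multiplicity. Hence Ext^1(M_n, M_(n+1)) = 0, the sequence
    0 -> M_(n+1) -> P -> M_n -> 0 splits and M_n is projective. Finally, a
    totally reflexive module with a projective syzygy is projective, because its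
    Ext^1 with values in projectives vanishes; so M is projective. *)

(** * Submodules and chain conditions *)

Section Submodules.
Variable S : pzRingType.
Implicit Types U V W : lmodType S.

Definition linear_of V W (f : V -> W) (f_lin : linear f) : {linear V -> W} :=
  HB.pack_for {linear V -> W} f (GRing.isLinear.Build _ _ _ _ f f_lin).

Definition is_submod V (A : set V) : Prop :=
  [/\ A 0, forall x y, A x -> A y -> A (x + y) & forall a x, A x -> A (a *: x)].

Lemma is_submodB V (A : set V) : is_submod A ->
  forall x y, A x -> A y -> A (x - y).
Proof. by case=> A0 AD AZ x y Ax Ay; rewrite -scaleN1r; apply/AD/AZ. Qed.

(** The closure proof [A_sub] belongs to the term, so that instance inference can recover the
    submodule structure from the type alone. *)
Definition submod_pred V (A : set V) (A_sub : is_submod A) : {pred V} :=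
  [pred x | `[< A x >]].

Lemma submod_pred_closed V (A : set V) (A_sub : is_submod A) :
  submod_closed (submod_pred A_sub).
Proof.
case: (A_sub) => A0 AD AZ; split; first exact/asboolP.
by move=> a x y /asboolP Ax /asboolP Ay; apply/asboolP/AD => //; apply: AZ.
Qed.
HB.instance Definition _ V (A : set V) (A_sub : is_submod A) :=
  GRing.isSubmodClosed.Build S V (submod_pred A_sub)
    (submod_pred_closed A_sub).

Record submod V (A : set V) (A_sub : is_submod A) :=
  Submod { submod_val : V; submod_valP : submod_val \in submod_pred A_sub }.
HB.instance Definition _ V (A : set V) (A_sub : is_submod A) :=
  [isSub for @submod_val V A A_sub].
HB.instance Definition _ V (A : set V) (A_sub : is_submod A) :=
  [Choice of submod A_sub by <:].
HB.instance Definition _ V (A : set V) (A_sub : is_submod A) :=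
  [SubChoice_isSubLmodule of submod A_sub by <:].

Section Inclusion.
Variables (V : lmodType S) (A : set V) (A_sub : is_submod A).

Lemma submod_val_linear : linear (@submod_val V A A_sub).
Proof. exact: (linearP (\val : submod A_sub -> V)). Qed.

Definition incl : {linear submod A_sub -> V} := linear_of submod_val_linear.

Lemma incl_inj : injective incl.
Proof. exact: val_inj. Qed.

Lemma inclP x : A (incl x).
Proof. by apply/asboolP; exact: (submod_valP x). Qed.

Lemma incl_surj v : A v -> exists x, incl x = v.
Proof. by move=> /asboolP Av; exists (Submod Av). Qed.

End Inclusion.

Lemma image_submod V W (f : {linear V -> W}) :
  is_submod [set w | exists v, f v = w]%classic.
Proof.
split; first by exists 0; rewrite linear0.
  by move=> _ _ [x <-] [y <-]; exists (x + y); rewrite linearD.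
by move=> a _ [x <-]; exists (a *: x); rewrite linearZ_LR.
Qed.

Lemma fun_of_rel (A B : Type) (r : A -> B -> Prop) :
  (forall x, exists y, r x y) -> exists f : A -> B, forall x, r x (f x).
Proof.
by move=> r_ex; exists (fun x => sval (cid (r_ex x))) => x; case: cid.
Qed.

(** A total functional relation compatible with linear combinations is the graph of a linear map.
    Factorizations through epimorphisms and monomorphisms are obtained in this way. *)
Lemma linear_of_rel U V (r : U -> V -> Prop) :
    (forall x, exists y, r x y) -> (forall x y z, r x y -> r x z -> y = z) ->
    (forall a x x' y y', r x y -> r x' y' -> r (a *: x + x') (a *: y + y')) ->
  exists f : {linear U -> V}, forall x, r x (f x).
Proof.
move=> /fun_of_rel[f rf] r_uniq r_lin.
have f_lin : linear f by move=> a x y; apply: r_uniq (rf _) _; apply: r_lin.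
by exists (linear_of f_lin).
Qed.

Lemma factor_epi U V W (g : {linear U -> V}) (f : {linear U -> W}) :
  surj g -> (forall x, g x = 0 -> f x = 0) ->
  exists h : {linear V -> W}, forall x, h (g x) = f x.
Proof.
move=> g_surj ker_gf.
have [||a x x' y y' [u] [<- <-] [u'] [<- <-]|h hP] :=
    @linear_of_rel V W (fun v w => exists u, g u = v /\ f u = w).
- by move=> v; have [u <-] := g_surj v; exists (f u), u.
- move=> v y z [u [<- <-]] [u' [/eqP]]; rewrite -subr_eq0 -linearB => /eqP.
  by move=> /ker_gf; rewrite linearB => /subr0_eq -> <-.
- by exists (a *: u + u'); rewrite !linearP.
exists h => x; have [u [gu <-]] := hP (g x); apply/eqP.
by rewrite -subr_eq0 -linearB; apply/eqP/ker_gf; rewrite linearB gu subrr.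
Qed.

Lemma factor_mono U V W (i : {linear U -> V}) (f : {linear W -> V}) :
  injective i -> (forall w, exists u, i u = f w) ->
  exists h : {linear W -> U}, forall w, i (h w) = f w.
Proof.
move=> i_inj f_im; apply: (@linear_of_rel W U (fun w u => i u = f w)) => //.
- by move=> x y z <- /i_inj.
- by move=> a x x' y y' eq_x eq_x'; rewrite !linearP eq_x eq_x'.
Qed.

Lemma image_corestriction V W (f : {linear V -> W}) :
  exists g : {linear V -> submod (image_submod f)},
    surj g /\ forall x, incl (image_submod f) (g x) = f x.
Proof.
have inj := @incl_inj _ _ (image_submod f).
have [x|g gP] := @factor_mono _ _ _ _ f inj.
  by apply: incl_surj; exists x.
exists g; split=> // y; have [x xy] := inclP y.
by exists x; apply: inj; rewrite gP.
Qed.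

Lemma bijective_linear V W (f : {linear V -> W}) : injective f -> surj f ->
  exists g : {linear W -> V}, cancel f g /\ cancel g f.
Proof.
move=> f_inj f_surj.
have [//|g gP] := @factor_mono _ _ _ f (idfun : {linear W -> W}) f_inj.
by exists g; split=> // x; apply: f_inj; rewrite gP.
Qed.

End Submodules.

Section ChainConditions.
Variable S : pzRingType.
Implicit Types V W : lmodType S.

(** The recursion splits off one generator at a time, which suits inductions on the list of
    generators. *)
Fixpoint span V (s : seq V) : set V :=
  if s is v :: s' then [set x | exists a, span s' (x - a *: v)] else [set 0].

Lemma span_submod V (s : seq V) : is_submod (span s).
Proof.
elim: s => [|v s [s0 sD sZ]] /=; first split => [//|_ _ -> ->|a _ ->] /=.
- by rewrite addr0.
- by rewrite scaler0.
split.
- by exists 0; rewrite scale0r subr0.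
- move=> x y [a sx] [b sy]; exists (a + b).
  by rewrite scalerDl opprD addrACA; apply: sD.
- by move=> c x [a sx]; exists (c * a); rewrite -scalerA -scalerBr; apply: sZ.
Qed.

Lemma span_cons V (v : V) s x : span s x -> span (v :: s) x.
Proof. by exists 0; rewrite scale0r subr0. Qed.

Lemma span_head V (v : V) s : span (v :: s) v.
Proof. by exists 1; rewrite scale1r subrr; case: (span_submod s). Qed.

Lemma span_least V (A : set V) (s : seq V) : is_submod A ->
  {in s, forall v, A v} -> forall x, span s x -> A x.
Proof.
move=> A_sub; have [A0 AD AZ] := A_sub; elim: s => [_ _ -> //|v s IHs] sA x.
move=> /= [a /IHs xA]; rewrite -[x](subrK (a *: v)); apply: AD.
  by apply: xA => w ws; apply: sA; rewrite inE ws orbT.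
by apply/AZ/sA; rewrite mem_head.
Qed.

Lemma span_mem V (s : seq V) v : v \in s -> span s v.
Proof.
elim: s => // w s IHs; rewrite inE => /predU1P[->|/IHs]; first exact: span_head.
exact: span_cons.
Qed.

Lemma span_catP V (s t : seq V) x :
  span (s ++ t) x <-> exists y, span s y /\ span t (x - y).
Proof.
elim: s x => [|v s IHs] x /=; first split.
- by move=> tx; exists 0; rewrite subr0.
- by move=> [_ [->]]; rewrite subr0.
split=> [[a /IHs[y [sy ty]]]|[y [[a sy] ty]]].
  exists (a *: v + y); split; last by rewrite opprD addrA.
  by exists a; rewrite addrAC subrr add0r.
exists a; apply/IHs; exists (y - a *: v); split=> //.
by rewrite opprB addrA subrK.
Qed.

Lemma fin_gen_span V : fin_gen V <-> exists s : seq V, forall x, span s x.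
Proof.
split=> [[n [e e_gen]]|[s s_gen]].
  exists (codom e) => x; have [c ->] := e_gen x.
  have [s0 sD sZ] := span_submod (codom e).
  by elim/big_ind: _ => // i _; apply/sZ/span_mem/codom_f.
exists (size s), (tnth (in_tuple s)) => x.
suff: exists c : nat -> S, x = \sum_(i < size s) c i *: s`_i.
  case=> c ->; exists (fun i => c i); apply: eq_bigr => i _.
  by rewrite (tnth_nth 0).
move: {s_gen} (s_gen x); elim: s x => [_ ->|v s IHs x /= [a /IHs[c]]].
  by exists (fun=> 0); rewrite big_ord0.
move=> /eqP; rewrite subr_eq => /eqP ->.
exists (fun i => if i is j.+1 then c j else a).
by rewrite big_ord_recl addrC.
Qed.

Definition noetherian V := forall A : set V, is_submod A ->
  exists s : seq V, {in s, forall v, A v} /\ forall x, A x -> span s x.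

Definition dcc V := forall A : nat -> set V,
  (forall n, is_submod (A n)) -> (forall n x, A n.+1 x -> A n x) ->
  exists N, forall n, (N <= n)%N -> forall x, A N x -> A n x.

Lemma decreasing_le (T : Type) (A : nat -> set T) :
  (forall n x, A n.+1 x -> A n x) ->
  forall m n, (m <= n)%N -> forall x, A n x -> A m x.
Proof.
move=> A_dec m n /subnK <-; elim: (n - m)%N => // k IHk x.
by rewrite addSn => /A_dec/IHk.
Qed.

(** The analogue of an ideal of leading coefficients: the coefficients at [v], modulo [W], of
    elements of [A]. *)
Definition coef_ideal V (A W : set V) (v : V) : set S^o :=
  [set a | exists x, A x /\ W (x - a *: v)].

Lemma coef_ideal_submod V (A W : set V) v :
  is_submod A -> is_submod W -> is_submod (coef_ideal A W v).
Proof.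
move=> [A0 AD AZ] [W0 WD WZ]; split.
- by exists 0; split=> //; rewrite [0 *: v]scale0r subr0.
- move=> a b [x [Ax Wx]] [y [Ay Wy]]; exists (x + y); split; first exact: AD.
  have -> : @GRing.scale S V (a + b) v =
    @GRing.scale S V a v + @GRing.scale S V b v by exact: scalerDl.
  by rewrite opprD addrACA; apply: WD.
- move=> c a [x [Ax Wx]]; exists (c *: x); split; first exact: AZ.
  have -> : @GRing.scale S V (c * a) v = c *: @GRing.scale S V a v.
    by rewrite scalerA.
  by rewrite -scalerBr; apply: WZ.
Qed.

(** Induction on the generators: within [span (v :: s)], a chain is controlled by its coefficient
    ideals at [v] and by its traces on [span s]. *)
Lemma dcc_fin_gen V : dcc S^o -> fin_gen V -> dcc V.
Proof.
move=> dccS /fin_gen_span[s s_gen] A A_sub A_dec.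
suff [N NP] : exists N, forall n, (N <= n)%N ->
    forall x, span s x -> A N x -> A n x.
  by exists N => n leNn x; apply: NP.
elim: s {s_gen} => [|v s [N1 IHs]].
  by exists 0%N => n _ x -> _; case: (A_sub n).
have [n||N2 HN2] := dccS (fun n => coef_ideal (A n) (span s) v).
- exact: coef_ideal_submod (A_sub n) (span_submod s).
- by move=> n a [x [Ax sx]]; exists x; split=> //; apply: A_dec.
have A_le := decreasing_le A_dec.
exists (maxn N1 N2) => n; rewrite geq_max => /andP[leN1 leN2] x [a sx] Ax.
(* As [x] and [y] have the same coefficient at [v], the difference [x - y] lies in [span s], where
   the induction hypothesis applies. *)
have [y [Ay sy]] : coef_ideal (A n) (span s) v a.
  by apply: HN2 => //; exists x; split=> //; apply: A_le Ax; exact: leq_maxr.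
rewrite -[x](subrK y); case: (A_sub n) => _ AD _; apply: AD => //.
apply: (IHs n leN1).
  rewrite -[x](subrK (a *: v)) -addrA -[a *: v - y]opprB.
  exact: is_submodB (span_submod s) _ _ _ _.
apply: is_submodB (A_sub _) _ _ _ _; last exact: A_le leN1 _ Ay.
by apply: A_le Ax; rewrite leq_maxl.
Qed.

(** The generators are those of the trace of [A] on [span s], together with elements of [A] whose
    coefficients at [v] generate the coefficient ideal. *)
Lemma noetherian_fin_gen V : noetherian S^o -> fin_gen V -> noetherian V.
Proof.
move=> noethS /fin_gen_span[s s_gen] A A_sub.
suff [t [tA tP]] : exists t : seq V,
    {in t, forall v, A v} /\ forall x, span s x -> A x -> span t x.
  by exists t; split=> // x Ax; apply: tP.
elim: s {s_gen} => [|v s [t1 [t1A t1P]]].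
  by exists [::]; split.
have I_sub := coef_ideal_submod v A_sub (span_submod s).
have [gens [asI asP]] := noethS _ I_sub.
have [t2 [t2A t2P]] : exists t2 : seq V, {in t2, forall v, A v} /\
    forall a : S, span gens a -> exists y, span t2 y /\ span s (y - a *: v).
  elim: gens asI {asP} => [_|b gens IHas asI].
    exists [::]; split=> // a /= ->; exists 0.
    by rewrite [0 *: v]scale0r subr0; split=> //; case: (span_submod s).
  have [|t2 [t2A t2P]] := IHas.
    by move=> w w_in; apply: asI; rewrite inE w_in orbT.
  have [y [Ay sy]] := asI b (mem_head _ _).
  exists (y :: t2); split=> [w|a /= [c /t2P[z [t2z sz]]]].
    by rewrite inE => /predU1P[->//|/t2A].
  exists (z + c *: y); split; first by exists c; rewrite addrK.
  have [_ sD sZ] := span_submod s.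
  have -> : z + c *: y - a *: v =
      (z - (a - c * (b : S)) *: v) + c *: (y - (b : S) *: v).
    rewrite scalerBr scalerA scalerBl opprB addrACA; congr (_ + _).
    by rewrite addrAC subrr add0r.
  by apply: sD => //; exact: sZ.
exists (t2 ++ t1); split=> [w|x [a sx] Ax].
  by rewrite mem_cat => /orP[/t2A|/t1A].
have [|y [t2y sy]] := t2P a; first by apply: asP; exists x.
apply/span_catP; exists y; split=> //; apply: t1P.
  rewrite -[x](subrK (a *: v)) -addrA -[a *: v - y]opprB.
  exact: is_submodB (span_submod s) _ _ _ _.
by apply: (is_submodB A_sub) Ax _; apply: span_least A_sub t2A _ t2y.
Qed.

Lemma noetherian_acc V : noetherian V -> forall A : nat -> set V,
  (forall n, is_submod (A n)) -> (forall n x, A n x -> A n.+1 x) ->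
  exists N, forall n x, A n x -> A N x.
Proof.
move=> noethV A A_sub A_inc.
have A_le m n : (m <= n)%N -> forall x, A m x -> A n x.
  by move=> /subnK <-; elim: (n - m)%N => // k IHk x /IHk/A_inc.
have [|s [sA sP]] := noethV [set x | exists n, A n x]%classic.
  split=> [|x y [m Ax] [n Ay]|a x [n Ax]].
  - by exists 0%N; case: (A_sub 0%N).
  - exists (maxn m n); case: (A_sub (maxn m n)) => _ AD _.
    by apply: AD; [apply: A_le Ax|apply: A_le Ay]; rewrite ?leq_maxl ?leq_maxr.
  - by exists n; case: (A_sub n) => _ _; apply.
suff [N NP] : exists N, {in s, forall v, A N v}.
  exists N => n x Ax; apply: span_least (A_sub N) NP _ _; apply: sP.
  by exists n.
elim: s sA {sP} => [_|v s IHs sA]; first by exists 0%N.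
have [|N NP] := IHs; first by move=> w ws; apply: sA; rewrite inE ws orbT.
have [m Am] := sA v (mem_head _ _); exists (maxn N m) => w.
rewrite inE => /predU1P[->|/NP]; first by apply: A_le Am; exact: leq_maxr.
by apply: A_le; exact: leq_maxl.
Qed.

(** Without a minimal element, choice would build an infinite strictly descending chain. *)
Lemma dcc_minimal V (Q : set V -> Prop) : dcc V ->
    (exists2 A, is_submod A & Q A) ->
  exists A, [/\ is_submod A, Q A & forall B, is_submod B -> Q B ->
    (forall x, B x -> A x) -> forall x, A x -> B x].
Proof.
move=> dccV [A0 A0_sub QA0]; apply: contrapT => no_min.
have step (A : {A : set V | is_submod A /\ Q A}) :
    exists B : {B : set V | is_submod B /\ Q B},
      (forall x, sval B x -> sval A x) /\ exists x, sval A x /\ ~ sval B x.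
  case: A => A [A_sub QA]; apply: contrapT => noB; apply: no_min.
  exists A; split=> // B B_sub QB subBA x Ax; apply: contrapT => nBx.
  apply: noB.
  exists (exist (fun B => is_submod B /\ Q B) B (conj B_sub QB)).
  by split; last by exists x.
have [f fP] := fun_of_rel step.
pose c n := iter n f (exist (fun B => is_submod B /\ Q B) A0 (conj A0_sub QA0)).
have [n|n x|N NP] := dccV (fun n => sval (c n)).
- by case: (c n) => ? [].
- by case: (fP (c n)) => + _; apply.
have [_ [x [cx ncx]]] := fP (c N).
by apply: ncx; apply: (NP N.+1).
Qed.

End ChainConditions.

(** * Artinian commutative rings and Artin algebras *)

Section ArtinianRing.
Variable R : comNzRingType.
Hypothesis R_artinian : artinian R.

Lemma artinian_dcc : dcc R^o.
Proof.
move=> A A_sub A_dec.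
have [n|//|N NP] := R_artinian (I := A); first by case: (A_sub n) => *; split.
by exists N => n leNn x; rewrite (NP n leNn).
Qed.

Section MinimalIdeal.
(* Let I be minimal among the ideals that are not finitely generated. Every
   scalar kills I or maps it onto itself, so I is an infinite-dimensional vector
   space over the field R / Ann I, against the descending chain condition. *)
Variable I : set R^o.
Hypothesis I_sub : is_submod I.
Let fin_gen_set (A : set R^o) :=
  exists s : seq R^o, {in s, forall v, A v} /\ forall x, A x -> span s x.
Hypothesis I_not_fg : ~ fin_gen_set I.
Hypothesis I_min : forall A : set R^o, is_submod A ->
  (forall x, A x -> I x) -> fin_gen_set A \/ forall x, I x -> A x.

(** Minimality is applied to the image [aI] and the kernel [Ia] of multiplication by [a] on [I].
    Were both finitely generated, so would be [I]: lifts of generators of [aI] together with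
    generators of [Ia] span it. *)
Lemma scalar_kills_or_surj (a : R) :
  (forall x, I x -> a * x = 0) \/
  forall x, I x -> exists2 y, I y & a * y = x.
Proof.
have [I0 ID IZ] := I_sub.
pose aI : set R^o := [set x | exists2 y, I y & a * y = x]%classic.
pose Ia : set R^o := [set x | I x /\ a * x = 0]%classic.
have aI_sub : is_submod aI.
  split; first by exists 0; rewrite ?mulr0.
    by move=> _ _ [x Ix <-] [y Iy <-]; exists (x + y);
      [apply: ID|rewrite mulrDr].
  by move=> c _ [x Ix <-]; exists (c * x); [apply: IZ|rewrite mulrCA].
have Ia_sub : is_submod Ia.
  split; first by rewrite /Ia /= mulr0.
    move=> x y [Ix ax] [Iy ay]; split; first exact: ID.
    by rewrite mulrDr ax ay addr0.
  by move=> c x [Ix ax]; split; [apply: IZ|rewrite mulrCA ax mulr0].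
have [_ [y Iy <-]|[s [sI sP]]|] := I_min aI_sub; [exact: IZ| |by right].
have [x []//|[t [tI tP]]|kill] := I_min Ia_sub; last by left=> x /kill[].
case: I_not_fg.
have [s' [s'I s'P]] : exists s' : seq R^o, {in s', forall v, I v} /\
    forall x, span s x -> exists2 y, span s' y & a * y = x.
  elim: s sI {sP} => [_|v s IHs sI].
    by exists [::]; split=> // x /= ->; exists 0; rewrite ?mulr0.
  have [w Iw aw] := sI v (mem_head _ _).
  have [|s' [s'I s'P]] := IHs.
    by move=> u us; apply: sI; rewrite inE us orbT.
  exists (w :: s'); split=> [u|x /= [c /s'P[y s'y ay]]].
    by rewrite inE => /predU1P[->|/s'I].
  exists (y + c * w); first by exists c; rewrite addrK.
  by rewrite mulrDr mulrCA aw ay [_ - _ + _]subrK.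
exists (s' ++ t); split=> [u|x Ix].
  by rewrite mem_cat => /orP[/s'I//|/tI[]].
have [|y s'y ay] := s'P (a * x); first by apply: sP; exists x.
apply/span_catP; exists y; split=> //; apply: tP; split.
  by apply: is_submodB => //; apply: span_least s'y.
by rewrite mulrBr ay subrr.
Qed.

(** The chain of principal ideals of the powers of [a] stabilizes, so [a ^+ N = a ^+ N.+1 * b] for
    some [b]. Every [x] in [I] has the form [a ^+ N * y], hence [b * (a * x) = x]. *)
Lemma surj_scalar_inv (a : R) :
  (forall x, I x -> exists2 y, I y & a * y = x) ->
  exists b, forall x, I x -> b * (a * x) = x.
Proof.
move=> aI; have aNI n x : I x -> exists2 y, I y & a ^+ n * y = x.
  elim: n x => [|n IHn] x; first by exists x; rewrite ?mul1r.
  by move=> /aI[y /IHn[z Iz <-] <-]; exists z; rewrite // exprS mulrA.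
pose J n : set R^o := [set x | exists c, x = a ^+ n * c]%classic.
have [n|n _ [c ->]|N NP] := @artinian_dcc J.
- split; first by exists 0; rewrite mulr0.
    by move=> _ _ [x ->] [y ->]; exists (x + y); rewrite mulrDr.
  by move=> c _ [x ->]; exists (c * x); apply: mulrCA.
- by exists (a * c); rewrite mulrA exprSr.
have [||b bP] := NP N.+1 _ (a ^+ N); first exact: leqnSn.
  by exists 1; rewrite mulr1.
exists b => x /(aNI N)[y _ <-].
by rewrite mulrA [b * a]mulrC mulrA -[_ * b * _]mulrA [b * _]mulrC mulrA -exprS
  -bP.
Qed.

(** Elements [x n] of [I] are chosen outside the span of their predecessors; the spans of the tails
    of this sequence then form a strictly descending chain. *)
Lemma no_minimal_ideal : False.
Proof.
have [I0 ID IZ] := I_sub.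
(* The guard on [s] makes the choice total, with default value [0] for lists that leave [I]. *)
have pick (s : seq R^o) : exists x, {in s, forall v, I v} ->
    I x /\ ~ span s x.
  have [sI|] := pselect {in s, forall v, I v}; last by exists 0.
  apply: contrapT => no_x; apply: I_not_fg.
  exists s; split=> // x Ix; apply: contrapT => nsx.
  by apply: no_x; exists x.
have [f fP] := fun_of_rel pick.
pose s n := iter n (fun s => f s :: s) [::].
pose x n := f (s n).
have sS n : s n.+1 = x n :: s n by [].
have sI n : {in s n, forall v, I v}.
  elim: n => // n IHn v; rewrite sS inE => /predU1P[->|/IHn//].
  by case: (fP (s n)).
have xI n : I (x n) by case: (fP (s n)).
have xs n : ~ span (s n) (x n) by case: (fP (s n)).
(* The indices run from [N] to [N + m - 1], largest first, so that [span] splits off the newest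
   element. *)
pose tail N m := [seq x i | i <- rev (iota N m)].
have tailS N m : tail N m.+1 = x (N + m)%N :: tail N m.
  by rewrite /tail -addn1 iotaD rev_cat.
have s_le m n : (m <= n)%N -> forall z, span (s m) z ->
    span (s n) z.
  move=> /subnK <-; elim: (n - m)%N => // k IHk z /IHk sz.
  by rewrite addSn sS; apply: span_cons.
have tail_s N m z : span (tail N m) z -> span (s (N + m)%N) z.
  elim: m z => [|m IHm] z.
    by move=> /= ->; case: (span_submod (s (N + 0)%N)).
  by rewrite tailS addnS sS => -[c /IHm ?]; exists c.
have xN_tail N m : ~ span (tail N.+1 m) (x N).
  elim: m => [/= x0|m IHm].
    by apply: (xs N); rewrite x0; case: (span_submod (s N)).
  rewrite tailS => -[c sx].
  (* Either [c] annihilates the newest element, which drops out of the relation, or [c] is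
     invertible on [I], and the relation puts the newest element into the span of its
     predecessors. *)
  have [kill|/surj_scalar_inv[b bP]] := scalar_kills_or_surj c.
    by apply: IHm; move: sx; rewrite [c *: _]kill // subr0.
  apply: (xs (N.+1 + m)%N); rewrite -(bP _ (xI _)).
  have [_ _ sZ] := span_submod (s (N.+1 + m)%N); apply: (sZ b).
  rewrite -[c * _](subKr (x N)); apply: is_submodB (span_submod _) _ _ _ _.
    by apply: (s_le N.+1); [exact: leq_addr|rewrite sS; exact: span_head].
  exact: tail_s sx.
have [n|n z [m sz]|N NP] :=
  @artinian_dcc (fun N => [set z | exists m, span (tail N m) z]%classic).
- have tail_le m k z : span (tail n m) z -> span (tail n (m + k)%N) z.
    elim: k => [|k IHk] tz; first by rewrite addn0.
    by rewrite addnS tailS; apply/span_cons/IHk.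
  split; first by exists 0%N.
    move=> y z [m ty] [k tz]; exists (m + k)%N.
    have [_ sD _] := span_submod (tail n (m + k)%N).
    by apply: sD; [exact: tail_le|rewrite addnC; exact: tail_le].
  by move=> c z [m tz]; exists m; case: (span_submod (tail n m)) => _ _; apply.
- exists m.+1; rewrite /tail /= rev_cons map_rcons -cats1.
  apply/span_catP; exists z; split=> //.
  by rewrite subrr; case: (span_submod [:: x n]).
have [||m] := NP N.+1 _ (x N); [exact: leqnSn| |exact: xN_tail].
by exists 1%N; rewrite tailS addn0; exact: span_head.
Qed.

End MinimalIdeal.

Lemma artinian_noetherian : noetherian R^o.
Proof.
move=> A A_sub; apply: contrapT => A_not_fg.
have [|I [I_sub I_not_fg I_min]] := dcc_minimal (V := R^o)
    (Q := fun I => ~ exists s : seq R^o,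
      {in s, forall v, I v} /\ forall x, I x -> span s x) artinian_dcc.
  by exists A.
apply: (no_minimal_ideal I_sub I_not_fg) => B B_sub subBI.
by have [|/I_min] := pselect (exists s : seq R^o,
  {in s, forall v, B v} /\ forall x, B x -> span s x); [left|right; auto].
Qed.

End ArtinianRing.

(** * Chain conditions on the one-sided ideals of an Artin algebra *)

Section ArtinAlgebra.
Variables (R : comNzRingType) (L : algType R).
Hypothesis L_artin : artin_algebra L.

Let dccL : dcc L.
Proof. by apply: dcc_fin_gen L_artin.2; exact: artinian_dcc L_artin.1. Qed.

Let noethL : noetherian L.
Proof.
by apply: noetherian_fin_gen L_artin.2; exact: artinian_noetherian L_artin.1.
Qed.

(** Scalars act as multiplication by [a%:A], so one-sided ideals are [R]-submodules and inherit the
    chain conditions of the [R]-module [L]. *)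
Lemma left_ideal_submod (A : set L^o) :
  is_submod A -> is_submod (V := (L : lmodType R)) A.
Proof.
case=> A0 AD AZ; split=> // a x Ax.
have -> : a *: x = a%:A * (x : L) by rewrite -scalerAl mul1r.
exact: AZ.
Qed.

Lemma right_ideal_submod (A : set (L^c)^o) :
  is_submod A -> is_submod (V := (L : lmodType R)) A.
Proof.
case=> A0 AD AZ; split=> // a x Ax.
have -> : a *: x = (x : L) * a%:A by rewrite -scalerAr mulr1.
exact: AZ (a%:A : L) _ Ax.
Qed.

Lemma artin_dcc : dcc L^o.
Proof. by move=> A A_sub; apply: dccL => n; exact: left_ideal_submod. Qed.

Lemma artin_noetherian : noetherian L^o.
Proof.
move=> A A_sub; have [s [sA sP]] := noethL (left_ideal_submod A_sub).
exists s; split=> // x /sP; apply: span_least; last exact: (@span_mem _ L^o).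
exact/left_ideal_submod/span_submod.
Qed.

Lemma artin_noetherian_converse : noetherian (L^c)^o.
Proof.
move=> A A_sub; have [s [sA sP]] := noethL (right_ideal_submod A_sub).
exists s; split=> // x /sP.
apply: span_least; last exact: (@span_mem _ (L^c)^o).
exact/right_ideal_submod/span_submod.
Qed.

End ArtinAlgebra.

(** * Vanishing of Ext *)

Section Extensions.
Variable S : pzRingType.
Implicit Types K M N P Q U V W : lmodType S.

Definition short_exact K P M (i : {linear K -> P}) (e : {linear P -> M}) :=
  [/\ injective i, exact_at i e & surj e].

Definition extendable K P (i : {linear K -> P}) N :=
  forall u : {linear K -> N}, exists v : {linear P -> N},
    forall x, v (i x) = u x.

(* [ext_all n M N] and [ext_some n M N] both express Ext^(n+1)(M, N) = 0, by
   dimension shifting along all, resp. some, projective presentations. *)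
Fixpoint ext_all n M N : Prop :=
  forall K P (i : {linear K -> P}) (e : {linear P -> M}),
    short_exact i e -> projective P ->
    if n is m.+1 then ext_all m K N else extendable i N.

Fixpoint ext_some n M N : Prop :=
  exists K P (i : {linear K -> P}) (e : {linear P -> M}),
    [/\ short_exact i e, projective P &
       if n is m.+1 then ext_some m K N else extendable i N].

Lemma ker_submod U V (f : {linear U -> V}) :
  is_submod [set x | f x = 0]%classic.
Proof.
split=> [|x y fx fy|a x fx] /=; first exact: linear0.
  by rewrite linearD fx fy addr0.
by rewrite linearZ_LR fx scaler0.
Qed.

Lemma short_exact_ker U V (e : {linear U -> V}) :
  surj e -> short_exact (incl (ker_submod e)) e.
Proof.
split=> //; first exact: incl_inj.
move=> y; split=> [ey|[x <-]]; first exact: (incl_surj (ker_submod e) ey).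
exact: (inclP x).
Qed.

Lemma projective_retract P Q (i : {linear Q -> P}) (p : {linear P -> Q}) :
  (forall x, p (i x) = x) -> projective P -> projective Q.
Proof.
move=> pi projP U V g f g_surj.
have [h hP] := projP U V g (f \o p : {linear P -> V}) g_surj.
by exists (h \o i : {linear Q -> U}) => x /=; rewrite hP /= pi.
Qed.

Lemma split_epi_projective P M (e : {linear P -> M}) :
  surj e -> projective M -> exists s : {linear M -> P}, forall x, e (s x) = x.
Proof. by move=> e_surj /(_ P M e (idfun : {linear M -> M}) e_surj). Qed.

Definition stable_retract M' M := exists (a : {linear M' -> M})
    (b : {linear M -> M'}) Q (s : {linear M' -> Q}) (t : {linear Q -> M'}),
  projective Q /\ forall x, x - b (a x) = t (s x).

Section Comparison.
Variables (K P M : lmodType S) (i : {linear K -> P}) (e : {linear P -> M}).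
Variables (K' P' M' : lmodType S).
Variables (i' : {linear K' -> P'}) (e' : {linear P' -> M'}).
Hypotheses (ie : short_exact i e) (projP : projective P).
Hypotheses (ie' : short_exact i' e') (projP' : projective P').

Lemma stable_retract_lift : stable_retract M' M ->
  exists (a : {linear P' -> P}) (aK : {linear K' -> K})
    (bK : {linear K -> K'}) (c : {linear P' -> K'}),
    (forall x, i (aK x) = a (i' x)) /\
    (forall x, c (i' x) = x - bK (aK x)) /\
    exists b : {linear P -> P'}, forall x, i' (bK x) = b (i x).
Proof.
case: ie ie' => [i_inj ie_ex e_surj] [i'_inj ie'_ex e'_surj].
move=> [a [b [Q [s [t [projQ abst]]]]]].
have [al alP] := projP' (a \o e' : {linear P' -> M}) e_surj.
have [be beP] := projP (b \o e : {linear P -> M'}) e'_surj.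
have [t' t'P] := projQ _ _ e' t e'_surj.
have [|aK aKP] := @factor_mono S _ _ _ i (al \o i' : {linear K' -> P}) i_inj.
  by move=> x; apply/ie_ex; rewrite alP /= (ie'_ex _).2 ?linear0 //; exists x.
have [|bK bKP] := @factor_mono S _ _ _ i' (be \o i : {linear K -> P'}) i'_inj.
  by move=> x; apply/ie'_ex; rewrite beP /= (ie_ex _).2 ?linear0 //; exists x.
(* The map [e'] kills [d], since the defect of [b \o a] is [t \o s] and [t'] lifts [t]. On [K'] the
   last term vanishes, which leaves the identity minus [bK \o aK]. *)
pose d : {linear P' -> P'} := (idfun \- (be \o al)) \- (t' \o (s \o e')).
have [|c cP] := @factor_mono S _ _ _ i' d i'_inj.
  move=> x; apply/ie'_ex; rewrite /d /= !linearB /= beP /= alP /= t'P -abst.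
  by rewrite subrr.
exists al, aK, bK, c; split=> //; split; last by exists be.
move=> x; have e'0 : e' (i' x) = 0 by apply/ie'_ex; exists x.
by apply: i'_inj; rewrite cP linearB bKP /= aKP /d /= e'0 !linear0 addr0.
Qed.

Lemma stable_retract_syzygy : stable_retract M' M -> stable_retract K' K.
Proof.
move=> /stable_retract_lift[_ [aK [bK [c [_ [cP _]]]]]].
by exists aK, bK, P', i', c; split=> // x; rewrite cP.
Qed.

Lemma stable_retract_extendable N :
  stable_retract M' M -> extendable i N -> extendable i' N.
Proof.
move=> /stable_retract_lift[a [aK [bK [c [aP [cP _]]]]]] ext u.
have [v vP] := ext (u \o bK : {linear K -> N}).
exists ((v \o a) \+ (u \o c) : {linear P' -> N}) => x.
by rewrite /= -aP vP /= cP linearB addrC subrK.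
Qed.

End Comparison.

Lemma retract_stable M' M (a : {linear M' -> M}) (b : {linear M -> M'}) :
  (forall x, b (a x) = x) -> stable_retract M' M.
Proof.
move=> ba; exists a, b, 'rV[S]_0, (\0 : {linear M' -> 'rV[S]_0}).
exists (\0 : {linear 'rV[S]_0 -> M'}); split=> [U V g f g_surj|x].
  exists (\0 : {linear 'rV[S]_0 -> U}) => x.
  by rewrite linear0 [x]thinmx0 linear0.
by rewrite ba subrr.
Qed.

(** For [M' = M] this is independence of the presentation; in general, vanishing passes to stable
    summands. *)
Lemma ext_some_all n M' M N :
  stable_retract M' M -> ext_some n M N -> ext_all n M' N.
Proof.
elim: n M' M => [|n IHn] M' M sr [K [P [i [e [ie projP ext]]]]].
all: move=> K' P' i' e' ie' projP'.
  exact (stable_retract_extendable ie projP ie' projP' sr ext).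
exact: IHn (stable_retract_syzygy ie projP ie' projP' sr) ext.
Qed.

Lemma stable_retract_refl M : stable_retract M M.
Proof. by apply: (@retract_stable M M idfun idfun). Qed.

Lemma extendable_retract K P (i : {linear K -> P}) N N'
    (a : {linear N' -> N}) (b : {linear N -> N'}) :
  (forall x, b (a x) = x) -> extendable i N -> extendable i N'.
Proof.
move=> ba ext u; have [v vP] := ext (a \o u : {linear K -> N}).
by exists (b \o v : {linear P -> N'}) => x; rewrite /= vP /= ba.
Qed.

(** Vanishing is extendability at the last syzygy, so it passes to [N] from any class [F] of
    coefficients from which extendability does. The class is empty for a zero module and has two
    members for a product. *)
Lemma ext_all_coef (F : forall N, Prop) n M N :
    (forall K P (i : {linear K -> P}), (forall N', F N' -> extendable i N') ->
      extendable i N) ->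
  (forall N', F N' -> ext_all n M N') -> ext_all n M N.
Proof.
move=> FN; elim: n M => [|n IHn] M ext K P i e ie projP.
  by apply: FN => N' FN'; exact: ext FN' _ _ _ _ ie projP.
by apply: IHn => N' FN'; exact: ext FN' _ _ _ _ ie projP.
Qed.

Lemma ext_all_retract n M N N' (a : {linear N' -> N}) (b : {linear N -> N'}) :
  (forall x, b (a x) = x) -> ext_all n M N -> ext_all n M N'.
Proof.
move=> ba ext; apply: (@ext_all_coef (eq N)) => [K P i extN|_ <- //].
by apply: extendable_retract ba _; exact: extN.
Qed.

Lemma ext_all_prod n M N N' :
  ext_all n M N -> ext_all n M N' -> ext_all n M (N * N')%type.
Proof.
move=> ext ext'; apply: (@ext_all_coef (fun V => V = N \/ V = N')); last first.
  by move=> V [->|->].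
move=> K P i extNN' u.
have fst_lin : linear (fun x => (u x).1) by move=> c x y; rewrite linearP.
have snd_lin : linear (fun x => (u x).2) by move=> c x y; rewrite linearP.
have [v vP] := extNN' N (or_introl erefl) (linear_of fst_lin).
have [w wP] := extNN' N' (or_intror erefl) (linear_of snd_lin).
have vw_lin : linear (fun x => (v x, w x)).
  by move=> c x y; rewrite !linearP.
by exists (linear_of vw_lin) => x; rewrite /= vP wP /=; case: (u x).
Qed.

Lemma ext_all_zero n M N : zero_module N -> ext_all n M N.
Proof.
move=> N0; apply: (@ext_all_coef (fun=> False)) => // K P i _ u.
by exists (\0 : {linear P -> N}) => x; rewrite [RHS]N0.
Qed.

Lemma ext_all_shift n M N K P (i : {linear K -> P}) (e : {linear P -> M}) :
  short_exact i e -> projective P -> ext_all n.+1 M N -> ext_all n K N.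
Proof. by move=> ie projP /(_ _ _ _ _ ie projP). Qed.

(* From the long exact sequence of Ext(X, -). *)
Lemma ext_all_connecting n X M K P (i : {linear K -> P}) (e : {linear P -> M}) :
    short_exact i e -> ext_all n X M -> ext_all n.+1 X P -> ext_all n.+1 X K.
Proof.
case=> i_inj ie_ex e_surj.
elim: n X => [|n IHn] X extM extP X1 Q0 j0 q0 jq0 projQ0; last first.
  apply: IHn; first exact: extM _ _ _ _ jq0 projQ0.
  exact: extP _ _ _ _ jq0 projQ0.
move=> X2 Q1 j1 q1 jq1 projQ1 u.
have [_ jq1_ex q1_surj] := jq1.
(* Diagram chase: [i \o u] extends to [w] on [Q1]; [e \o w] descends to [w'] on [X1], which extends
   to [v] on [Q0] and lifts to [z] with values in [P]. Subtracting [z] from [w] leaves a map into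
   [K] that extends [u]. *)
have [w wP] := extP _ _ _ _ jq0 projQ0 _ _ _ _ jq1 projQ1
  (i \o u : {linear X2 -> P}).
have [x|w' w'P] := @factor_epi S _ _ _ q1 (e \o w : {linear Q1 -> M}) q1_surj.
  by move=> /jq1_ex[y <-] /=; rewrite wP /=; apply/ie_ex; exists (u y).
have [v vP] := extM _ _ _ _ jq0 projQ0 w'.
have [z zP] := projQ0 _ _ e v e_surj.
pose d : {linear Q1 -> P} := w \- (z \o (j0 \o q1)).
have [x|r rP] := @factor_mono S _ _ _ i d i_inj.
  by apply/ie_ex; rewrite /d /= linearB zP vP w'P subrr.
exists r => x; have q1_0 : q1 (j1 x) = 0 by apply/jq1_ex; exists x.
by apply: i_inj; rewrite rP /d /= wP /= q1_0 !linear0 addr0.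
Qed.

(** Extending the identity of [K] to [P] splits the sequence, so [M] is a direct summand of [P]. *)
Lemma ext_split M K P (i : {linear K -> P}) (e : {linear P -> M}) :
  short_exact i e -> projective P -> ext_all 0 M K -> projective M.
Proof.
move=> ie projP ext; have [i_inj ie_ex e_surj] := ie.
have [r ri] := ext _ _ _ _ ie projP (idfun : {linear K -> K}).
have [x /ie_ex[y <-]|s sP] :=
    @factor_epi S _ _ _ e (idfun \- (i \o r) : {linear P -> P}) e_surj.
  by rewrite /= ri subrr.
apply: (@projective_retract P M s e) => // x; have [y <-] := e_surj x.
have eir : e (i (r y)) = 0 by apply/ie_ex; exists (r y).
by rewrite sP /= linearB eir subr0.
Qed.

End Extensions.

(** * Finitely generated modules, free covers and resolutions *)

Section FinitelyGenerated.
Variable S : pzRingType.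
Implicit Types K M N P U V W : lmodType S.

Lemma fin_gen_surj U V (f : {linear U -> V}) : surj f -> fin_gen U -> fin_gen V.
Proof.
move=> f_surj [n [e e_gen]]; exists n, (f \o e) => v.
have [u <-] := f_surj v; have [c ->] := e_gen u; exists c.
by rewrite linear_sum; apply: eq_bigr => i _; rewrite linearZ_LR.
Qed.

Lemma fin_gen_row n : fin_gen 'rV[S]_n.
Proof.
by exists n, (fun i => delta_mx 0 i) => v; exists (v 0); exact: row_sum_delta.
Qed.

Lemma linear_of_row n V (e : 'I_n -> V) :
  linear (fun v : 'rV[S]_n => \sum_(i < n) v 0 i *: e i).
Proof.
move=> a x y; rewrite scaler_sumr -big_split; apply: eq_bigr => i _.
by rewrite !mxE scalerDl scalerA.
Qed.

Lemma projective_row n : projective 'rV[S]_n.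
Proof.
move=> U V g f g_surj.
have [u uP] := fun_of_rel (fun i : 'I_n => g_surj (f (delta_mx 0 i))).
exists (linear_of (linear_of_row u)) => v /=.
rewrite [in RHS](row_sum_delta v) !linear_sum; apply: eq_bigr => i _.
by rewrite !linearZ_LR uP.
Qed.

Lemma fin_gen_cover M : fin_gen M ->
  exists n (e : {linear 'rV[S]_n -> M}), surj e.
Proof.
move=> [n [e e_gen]]; exists n, (linear_of (linear_of_row e)) => x.
have [c ->] := e_gen x; exists (\row_i c i) => /=.
by apply: eq_bigr => i _; rewrite mxE.
Qed.

Lemma noetherian_submod V (A : set V) (A_sub : is_submod A) :
  noetherian V -> fin_gen (submod A_sub).
Proof.
move=> /(_ A A_sub)[s [sA sP]]; apply/fin_gen_span.
have [t ts] : exists t, [seq incl A_sub x | x <- t] = s.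
  elim: s sA {sP} => [_|v s IHs sA]; first by exists [::].
  have [x <-] := incl_surj A_sub (sA v (mem_head _ _)).
  have [|t <-] := IHs; first by move=> w ws; apply: sA; rewrite inE ws orbT.
  by exists (x :: t).
exists t => x; have := sP _ (inclP x); rewrite -{s sA sP}ts.
elim: t x => [|v t IHt] x.
  by move=> x0; apply: incl_inj; rewrite linear0.
move=> [a].
have <- : incl A_sub (x - a *: v) = incl A_sub x - a *: incl A_sub v.
  by rewrite linearB linearZ_LR.
by move=> /IHt; exists a.
Qed.

Hypothesis S_noetherian : noetherian S^o.

Lemma fin_gen_ker U V (f : {linear U -> V}) :
  fin_gen U -> fin_gen (submod (ker_submod f)).
Proof. by move=> fgU; apply/noetherian_submod/noetherian_fin_gen. Qed.

Lemma fin_gen_mono U V (f : {linear U -> V}) :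
  injective f -> fin_gen V -> fin_gen U.
Proof.
move=> f_inj fgV; have noethV := noetherian_fin_gen S_noetherian fgV.
have inj := @incl_inj _ _ _ (image_submod f).
have [g [g_surj gP]] := image_corestriction f.
have [|g' [gK g'K]] := bijective_linear _ g_surj.
  by move=> x y xy; apply: f_inj; rewrite -!gP xy.
apply: (@fin_gen_surj _ _ g' _ (noetherian_submod (image_submod f) noethV)).
by move=> x; exists (g x).
Qed.

Lemma ext_all_some n M N : fin_gen M -> ext_all n M N -> ext_some n M N.
Proof.
elim: n M => [|n IHn] M fgM ext; have [k [e e_surj]] := fin_gen_cover fgM.
all: have ie := short_exact_ker e_surj; have projP := @projective_row k.
all: exists _, _, (incl (ker_submod e)), e; split; [exact: ie|exact: projP|].
  exact: ext ie projP.
apply: IHn; first exact/fin_gen_ker/fin_gen_row.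
exact: ext ie projP.
Qed.

Lemma ext_all_stable n M' M N : fin_gen M -> stable_retract M' M ->
  ext_all n M N -> ext_all n M' N.
Proof. by move=> fgM sr /(ext_all_some fgM); exact: ext_some_all. Qed.

Section Resolution.

Let fgm := {M : lmodType S | fin_gen M}.

Let cover_ex (M : fgm) :
  exists ne : {n : nat & {linear 'rV[S]_n -> sval M}}, surj (projT2 ne).
Proof.
case: M => M fgM; have [n [e e_surj]] := fin_gen_cover fgM.
by exists (existT _ n e).
Qed.

Let rank (M : fgm) : nat := projT1 (sval (cid (cover_ex M))).
Let cover (M : fgm) : {linear 'rV[S]_(rank M) -> sval M} :=
  projT2 (sval (cid (cover_ex M))).
Let cover_surj (M : fgm) : surj (cover M) := svalP (cid (cover_ex M)).
Let syz (M : fgm) : fgm :=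
  exist (fun K : lmodType S => fin_gen K) (submod (ker_submod (cover M)))
  (fin_gen_ker (cover M) (@fin_gen_row (rank M))).
Let inc (M : fgm) : {linear sval (syz M) -> 'rV[S]_(rank M)} :=
  incl (ker_submod (cover M)).
Let inc_exact (M : fgm) : short_exact (inc M) (cover M) :=
  short_exact_ker (@cover_surj M).

(** The chosen free covers of the successive syzygies are spliced together. *)
Lemma resolution_exists M : fin_gen M -> inhabited (proj_resolution M).
Proof.
move=> fgM; pose Z n := iter n syz (exist (fun K => fin_gen K) M fgM).
have exact_step (X : fgm) V (f : {linear 'rV[S]_(rank X) -> V}) :
    (forall y, f y = 0 <-> cover X y = 0) ->
    exact_at (inc X \o cover (syz X)) f.
  have [_ ex _] := inc_exact X; move=> fX y; rewrite fX ex; split=> -[x <-].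
    by have [z <-] := cover_surj x; exists z.
  by exists (cover (syz X) x).
constructor; apply: (@ProjResolution S M (fun n => 'rV[S]_(rank (Z n)))
  (fun n => inc (Z n) \o cover (Z n.+1)) (cover (Z 0%N))).
- by move=> n; exact: projective_row.
- exact: (@cover_surj (Z 0%N)).
- exact: (@exact_step (Z 0%N)).
- move=> n; apply: (@exact_step (Z n.+1)) => y.
  have [inj _ _] := inc_exact (Z n).
  rewrite -[X in X = 0]/(inc (Z n) (cover (Z n.+1) y)).
  split=> [|->]; last by rewrite linear0.
  by rewrite -[RHS](linear0 (inc (Z n))) => /inj.
Qed.

End Resolution.

End FinitelyGenerated.

(** * Comparison of dimension shifting with the cohomology of resolutions *)

Section ExtVanish.
Variable S : pzRingType.
Implicit Types K M N : lmodType S.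

Definition vanishes M N (P : proj_resolution M) n :=
  forall f : {linear P n -> N}, cocycle f -> coboundary f.

Lemma aug_corestriction M (P : proj_resolution M) :
  exists a : {linear P 1%N -> submod (ker_submod (res_aug P))},
    surj a /\ forall x, incl (ker_submod (res_aug P)) (a x) = res_diff P 0 x.
Proof.
have iP := @incl_inj S _ _ (ker_submod (res_aug P)).
have [x|a aP] := @factor_mono S _ _ _ _ (res_diff P 0) iP.
  by apply: incl_surj; apply/res_exact0; exists x.
exists a; split=> // y; have [x xy] := (res_exact0 _).1 (inclP y).
by exists x; apply: iP; rewrite aP.
Qed.

(** By exactness, cocycles of degree 1 are the maps that factor through the kernel of the
    augmentation, and coboundaries those whose factor extends to [P 0]. *)
Lemma vanishes_extendable M N (P : proj_resolution M) :
  vanishes N P 1 <-> extendable (incl (ker_submod (res_aug P))) N.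
Proof.
have [a [a_surj aP]] := aug_corestriction P.
split=> [van u|ext f f_coc].
  have [|g gP] := van (u \o a : {linear P 1%N -> N}).
    move=> x /=; rewrite (_ : a _ = 0) ?linear0 //.
    apply: incl_inj; rewrite aP linear0; apply/res_exact; exists x.
    by [].
  by exists g => x; have [y <-] := a_surj x; rewrite aP -gP.
have [x|u uP] := @factor_epi S _ _ _ a f a_surj.
  move=> ax; have [y <-] : exists y, res_diff P 1 y = x.
    by apply/res_exact; rewrite -aP ax linear0.
  exact: f_coc.
have [v vP] := ext u; exists v => x.
by rewrite -aP vP uP.
Qed.

(** Dropping [P 0] leaves a resolution of the first syzygy, with all degrees lowered by one. *)
Lemma resolution_shift M (P : proj_resolution M) :
  exists Q : proj_resolution (submod (ker_submod (res_aug P))),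
    forall N n, vanishes N Q n.+1 <-> vanishes N P n.+2.
Proof.
have [a [a_surj aP]] := aug_corestriction P.
have a_exact : exact_at (res_diff P 1) a.
  move=> y; rewrite -res_exact -aP; split=> [->|]; first exact: linear0.
  by rewrite -[RHS](linear0 (incl (ker_submod (res_aug P)))) => /incl_inj.
by exists (@ProjResolution S (submod (ker_submod (res_aug P)))
  (fun n => P n.+1) (fun n => res_diff P n.+1) a
  (fun n => @res_projective _ _ P n.+1) a_surj a_exact
  (fun n => @res_exact _ _ P n.+1)).
Qed.

Lemma vanishes_ext_some n M N (P : proj_resolution M) :
  vanishes N P n.+1 -> ext_some n M N.
Proof.
elim: n M P => [|n IHn] M P van.
all: exists _, _, (incl (ker_submod (res_aug P))), (res_aug P).
all: split; [exact/short_exact_ker/res_aug_surj|exact: res_projective|].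
  exact/vanishes_extendable.
have [Q QP] := resolution_shift P; apply: (IHn _ Q).
exact/QP.
Qed.

Lemma ext_all_vanishes n M N (P : proj_resolution M) :
  ext_all n M N -> vanishes N P n.+1.
Proof.
elim: n M P => [|n IHn] M P ext.
all: have {}ext := ext _ _ _ _ (short_exact_ker (@res_aug_surj _ _ P))
  (@res_projective _ _ P 0).
  exact/vanishes_extendable.
have [Q QP] := resolution_shift P; apply/QP.
exact: IHn.
Qed.

Lemma Ext_vanish_ext_all n M N : Ext_vanish n.+1 M N -> ext_all n M N.
Proof.
move=> [P /(@vanishes_ext_some n)]; apply: ext_some_all.
exact: stable_retract_refl.
Qed.

Lemma ext_all_Ext_vanish n M N : noetherian S^o -> fin_gen M ->
  ext_all n M N -> Ext_vanish n.+1 M N.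
Proof.
move=> noethS fgM ext; have [P] := resolution_exists noethS fgM.
by exists P; exact: ext_all_vanishes.
Qed.

End ExtVanish.

(** * Duality and the transpose *)

Section DualBasis.
Variable S : pzRingType.
Implicit Types K M N P : lmodType S.

(** The data of the dual basis lemma, which characterize finitely generated projective modules. *)
Definition dual_basis P n (p : 'I_n -> P) (f : 'I_n -> {linear P -> S^o}) :=
  forall x, x = \sum_(i < n) (f i x : S) *: p i.

Lemma dual_basis_exists P : fin_gen P -> projective P ->
  exists n (p : 'I_n -> P) f, dual_basis p f.
Proof.
move=> /fin_gen_cover[n [e e_surj]] /(split_epi_projective e_surj)[s sP].
have f_lin i : linear (fun x => s x 0 i : S^o).
  by move=> a x y; rewrite linearP !mxE.
exists n, (fun i => e (delta_mx 0 i)), (fun i => linear_of (f_lin i)) => x.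
rewrite -[LHS]sP [in LHS](row_sum_delta (s x)) linear_sum.
by apply: eq_bigr => i _; rewrite linearZ_LR.
Qed.

Lemma dual_basis_fin_gen P n (p : 'I_n -> P) f : dual_basis p f -> fin_gen P.
Proof. by move=> pf; exists n, p => x; exists (fun i => f i x). Qed.

Lemma dual_basis_linear P n (f : 'I_n -> {linear P -> S^o}) N (v : 'I_n -> N) :
  linear (fun x => \sum_(i < n) (f i x : S) *: v i).
Proof.
move=> a x y; rewrite scaler_sumr -big_split; apply: eq_bigr => i _ /=.
rewrite linearP scalerA -scalerDl.
by [].
Qed.

Lemma dual_basis_projective P n (p : 'I_n -> P) f :
  dual_basis p f -> projective P.
Proof.
move=> pf U V g h g_surj.
have [u uP] := fun_of_rel (fun i => g_surj (h (p i))).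
exists (linear_of (dual_basis_linear f u)) => x /=.
rewrite [in RHS](pf x) !linear_sum; apply: eq_bigr => i _.
by rewrite !linearZ_LR uP.
Qed.

(** The coordinates given by a dual basis of [N] are extended one by one. *)
Lemma extendable_fin_gen_projective K P (i : {linear K -> P}) N :
  fin_gen N -> projective N -> extendable i S^o -> extendable i N.
Proof.
move=> fgN projN ext u; have [n [p [f pf]]] := dual_basis_exists fgN projN.
have [v vP] := fun_of_rel (fun j => ext (f j \o u : {linear K -> S^o})).
exists (linear_of (dual_basis_linear v p)) => x /=.
by rewrite [RHS]pf; apply: eq_bigr => j _; rewrite vP.
Qed.

Lemma ext_all_fin_gen_projective n M N :
  fin_gen N -> projective N -> ext_all n M S^o -> ext_all n M N.
Proof.
move=> fgN projN ext.
apply: (@ext_all_coef _ (@eq (lmodType S) S^o)) => [K P i extS|_ <- //].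
by apply: extendable_fin_gen_projective => //; exact: extS.
Qed.

End DualBasis.

Section Duality.
Variable L : pzRingType.
Implicit Types K M N P : lmodType L.

Lemma dual_map_linear M N (d : {linear M -> N}) : linear (dual_map d).
Proof. by move=> a f g; apply: dual_ext. Qed.

Definition dual_lin M N (d : {linear M -> N}) : {linear dual N -> dual M} :=
  linear_of (dual_map_linear d).

Lemma ev_linear M (x : M) : linear (fun f : dual M => f x : (L^c)^o).
Proof. by []. Qed.

Definition ev M (x : M) : {linear dual M -> (L^c)^o} := linear_of (ev_linear x).

(** Injectivity and surjectivity of evaluation into the bidual, stated elementwise. *)
Definition reflexive M :=
  (forall x : M, (forall f : dual M, f x = 0) -> x = 0) /\
  forall F : {linear dual M -> (L^c)^o}, exists x : M, forall f, F f = f x.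

Lemma dual_sum M n (g : 'I_n -> dual M) x :
  (\sum_(i < n) g i) x = \sum_(i < n) (g i x).
Proof. by elim/big_ind2: _ => // _ u _ v <- <-; rewrite dual_addE. Qed.

Section DualOfProjective.
Variables (P : lmodType L) (fgP : fin_gen P) (projP : projective P).

(** The roles of the two families are exchanged: the [f i] and the evaluations at the [p i] form a
    dual basis of the dual. *)
Let dual_decomp n (p : 'I_n -> P) (f : 'I_n -> {linear P -> L^o})
  (pf : dual_basis p f) (g : dual P) :
  g = \sum_(i < n) (ev (p i) g : L^c) *: (f i : dual P).
Proof.
apply: dual_ext => x.
apply: etrans
  (esym (dual_sum (fun i => (ev (p i) g : L^c) *: (f i : dual P)) x)).
rewrite [in LHS](pf x) /dual_fun linear_sum.
by apply: eq_bigr => i _; rewrite linearZ_LR.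
Qed.

Lemma fin_gen_dual : fin_gen (dual P).
Proof.
have [n [p [f pf]]] := dual_basis_exists fgP projP.
exact: (@dual_basis_fin_gen _ (dual P) n f (fun i => ev (p i))
  (dual_decomp pf)).
Qed.

Lemma projective_dual : projective (dual P).
Proof.
have [n [p [f pf]]] := dual_basis_exists fgP projP.
exact: (@dual_basis_projective _ (dual P) n f (fun i => ev (p i))
  (dual_decomp pf)).
Qed.

Lemma reflexive_projective : reflexive P.
Proof.
have [n [p [f pf]]] := dual_basis_exists fgP projP; split=> [x x0|F].
  by rewrite (pf x) big1 // => i _; rewrite [f i x](x0 (f i)) scale0r.
exists (\sum_(i < n) (F (f i) : L) *: p i) => g.
rewrite [in LHS](dual_decomp pf g) /dual_fun !linear_sum.
by apply: eq_bigr => i _; rewrite !linearZ_LR.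
Qed.

End DualOfProjective.

Lemma dual_left_exact K P M (d : {linear K -> P}) (e : {linear P -> M}) :
  surj e -> exact_at d e ->
  injective (dual_lin e) /\ exact_at (dual_lin e) (dual_lin d).
Proof.
move=> e_surj de; split=> [f g fg|f].
  apply: dual_ext => y; have [x <-] := e_surj y.
  exact (congr1 (fun h : dual P => h x) fg).
split=> [fd|[g <-]]; last first.
  have ed x : e (d x) = 0 by apply/de; exists x.
  by apply: dual_ext => x; rewrite -[LHS]/(g (e (d x))) ed; exact: linear0.
have [x|g gP] := @factor_epi L _ _ _ e (f : {linear P -> L^o}) e_surj.
  by move=> /de[y <-]; exact (congr1 (fun h : dual K => h y) fd).
by exists g; apply: dual_ext => x; exact: gP.
Qed.

Lemma dual_short_exact K P M (i : {linear K -> P}) (e : {linear P -> M}) :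
  short_exact i e -> extendable i L^o -> short_exact (dual_lin e) (dual_lin i).
Proof.
case=> i_inj ie e_surj ext; have [inj ex] := dual_left_exact e_surj ie.
split=> // u; have [v vP] := ext (u : {linear K -> L^o}).
by exists v; apply: dual_ext.
Qed.

Section Transposition.
Variables (P1 P0 M : lmodType L) (d : {linear P1 -> P0}) (e : {linear P0 -> M}).
Variables (T : lmodType L^c) (q : {linear dual P1 -> T}).
Hypotheses (fgP1 : fin_gen P1) (fgP0 : fin_gen P0).
Hypotheses (projP1 : projective P1) (projP0 : projective P0).
Hypotheses (e_surj : surj e) (de : exact_at d e).
Hypotheses (q_surj : surj q) (dq : exact_at (dual_map d) q).

Let Z := submod (ker_submod q).
Let Zq : short_exact (incl (ker_submod q)) q := short_exact_ker q_surj.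

(** [Z] is both the kernel of [q] and the image of the dual of [d], so the dual of [M] is a syzygy
    of [Z], itself a syzygy of [T]. *)
Lemma transpose_syzygy : exists a : {linear dual P0 -> Z},
  (forall f, incl (ker_submod q) (a f) = dual_map d f) /\
  short_exact (dual_lin e) a.
Proof.
have inc_inj := @incl_inj _ _ _ (ker_submod q).
have [f|a aP] := @factor_mono _ _ _ _ _ (dual_lin d) inc_inj.
  by apply: incl_surj; apply/dq; exists f.
exists a; split=> //; have [inj ex] := dual_left_exact e_surj de; split=> //.
  move=> f; rewrite -ex -aP; split=> [->|]; first exact: linear0.
  by rewrite -[RHS](linear0 (incl (ker_submod q))) => /inc_inj.
move=> z; have [f fP] := (dq _).1 (inclP z).
by exists f; apply: inc_inj; rewrite aP.
Qed.

(* Auslander-Bridger: M is torsionless, resp. reflexive, once Ext^1(Tr M, L),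
   resp. also Ext^2(Tr M, L), vanishes; and M^* is a second syzygy of Tr M. *)
Lemma ext_transpose_dual : (forall n, ext_all n T (L^c)^o) ->
  reflexive M /\ forall n, ext_all n (dual M) (L^c)^o.
Proof.
move=> extT; have [a [aP Za]] := transpose_syzygy.
have projP1' := projective_dual fgP1 projP1.
have projP0' := projective_dual fgP0 projP0.
have extZ n : ext_all n Z (L^c)^o := extT n.+1 _ _ _ _ Zq projP1'.
split; last by move=> n; exact (extZ n.+1 _ _ _ _ Za projP0').
have [P0_tl P0_ev] := reflexive_projective fgP0 projP0.
split=> [m m0|F]; last first.
  have [F' F'P] := extZ 0%N _ _ _ _ Za projP0' F; have [p pP] := P0_ev F'.
  by exists (e p) => f; rewrite -F'P pP.
have [p pm] := e_surj m; have [_ Za_ex a_surj] := Za.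
(* As [m] is killed by all functionals, [ev p] factors through [Z]. The factor extends to the dual
   of [P1], where it is evaluation at some [p1]; then [p = d p1] and [m = 0]. *)
have [f|u uP] := @factor_epi _ _ _ _ a (ev p) a_surj.
  by move=> /Za_ex[g <-]; rewrite -(m0 g) -pm.
have [v vP] := extT 0%N _ _ _ _ Zq projP1' u.
have [p1 p1P] := (reflexive_projective fgP1 projP1).2 v.
rewrite -pm; apply/de; exists p1; apply/eqP; rewrite -subr_eq0; apply/eqP.
apply: P0_tl => f; rewrite /dual_fun linearB; apply/eqP; rewrite subr_eq0.
apply/eqP; rewrite -[RHS]/(ev p f) -uP -vP aP.
by rewrite p1P.
Qed.

(** Degrees at least 3 reduce to the dual of [M]. Degree 2 uses that evaluation into the bidual is
    surjective, and degree 1 that it is injective. *)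
Lemma ext_dual_transpose : reflexive M ->
  (forall n, ext_some n (dual M) (L^c)^o) -> forall n, ext_some n T (L^c)^o.
Proof.
move=> [M_tl M_ev] extM; have [a [aP Za]] := transpose_syzygy.
have projP1' := projective_dual fgP1 projP1.
have projP0' := projective_dual fgP0 projP0.
case=> [|n]; exists _, _, (incl (ker_submod q)), q; split=> //; last first.
  case: n => [|n]; exists _, _, (dual_lin e), a; split=> // F.
  have [m mP] := M_ev F; have [p pm] := e_surj m.
  by exists (ev p) => f; rewrite mP -pm.
move=> F; have [p pP] := (reflexive_projective fgP0 projP0).2 (F \o a).
have [p1 dp1] : exists p1, d p1 = p.
  have [_ ex _] := Za; apply/de/M_tl => f.
  have af0 : a (dual_lin e f) = 0 by apply/ex; exists f.
  by rewrite -[LHS]/(dual_lin e f p) -pP /= af0 linear0.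
exists (ev p1) => z; have [_ _ a_surj] := Za; have [f <-] := a_surj z.
by rewrite aP -[RHS]/((F \o a) f) pP -dp1.
Qed.

End Transposition.

End Duality.

(** * Projective covers *)

Section ProjectiveCovers.
Variable L : pzRingType.
Implicit Types M N P U V : lmodType L.

(** The kernels of the iterates stabilize at some [N]. An element of the kernel of [h] is
    [iter N h z] for some [z]; then [z] is killed by the iterate [N.+1], hence already by the
    iterate [N]. *)
Lemma surj_endo_inj V (h : {linear V -> V}) :
  noetherian V -> surj h -> injective h.
Proof.
move=> noethV h_surj.
have iter_lin n : linear (iter n h).
  by elim: n => [|n IHn] a x y //=; rewrite IHn linearP.
have [n|n x /= ->|N NP] :=
    noetherian_acc noethV (A := fun n => [set x | iter n h x = 0]%classic).
- exact: ker_submod (linear_of (iter_lin n)).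
- exact: linear0.
have iter_surj n : surj (iter n h).
  elim: n => [|n IHn] y; first by exists y.
  by have [z <-] := h_surj y; have [x <-] := IHn z; exists x.
move=> x y hxy; apply/eqP; rewrite -subr_eq0; apply/eqP.
have [z zP] := iter_surj N (x - y).
by rewrite -zP; apply: (NP N.+1); rewrite /= zP linearB hxy subrr.
Qed.

Hypothesis L_dcc : dcc L^o.
Hypothesis L_noetherian : noetherian L^o.

(* A minimal submodule A of a free module V among those mapping onto M is a
   projective cover: lift V -> M to h : V -> A; by minimality h maps A onto A,
   hence bijectively, so A is a retract of V. *)
Lemma projective_cover M : fin_gen M ->
  exists P (e : {linear P -> M}),
    [/\ fin_gen P, projective P, surj e & essential_onto_image e].
Proof.
move=> /fin_gen_cover[n [e0 e0_surj]].
have dccV := dcc_fin_gen L_dcc (@fin_gen_row L n).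
have noethV := noetherian_fin_gen L_noetherian (@fin_gen_row L n).
have [|A [A_sub AM A_min]] :=
    dcc_minimal (Q := fun A => forall m, exists2 x, A x & e0 x = m) dccV.
  exists setT => [|m]; first by split.
  by have [x <-] := e0_surj m; exists x.
pose P : lmodType L := submod A_sub.
pose e : {linear P -> M} := e0 \o incl A_sub.
have e_surj : surj e.
  move=> m; have [x Ax <-] := AM m; have [y <-] := incl_surj A_sub Ax.
  by exists y.
have surj_onto (X : lmodType L) (g : {linear X -> P}) :
    (forall a, exists x, e (g x) = e a) -> surj g.
  move=> eg y.
  pose g' : {linear X -> 'rV[L]_n} := incl A_sub \o g.
  have [m|_ [x <-]|x xy] := A_min _ (image_submod g') _ _ _ (inclP y).
  - have [a <-] := e_surj m; have [x <-] := eg a.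
    by exists (g' x) => //; exists x.
  - exact: inclP.
  - by exists x; exact: incl_inj xy.
have fgP : fin_gen P by exact: noetherian_submod.
have [h hP] := projective_row e0 e_surj.
pose hA : {linear P -> P} := h \o incl A_sub.
have hA_surj : surj hA by apply: surj_onto => a; exists a; exact: hP.
have hA_inj := surj_endo_inj (noetherian_fin_gen L_noetherian fgP) hA_surj.
have [k [hK _]] := bijective_linear hA_inj hA_surj.
exists P, e; split=> //.
apply: (@projective_retract _ 'rV[L]_n P (incl A_sub) (k \o h)) => [x|].
  exact: hK.
exact: projective_row.
Qed.

Lemma min_presentation M : fin_gen M ->
  exists P1 P0 (d : {linear P1 -> P0}) (e : {linear P0 -> M}),
    [/\ fin_gen P1, fin_gen P0 & min_proj_presentation d e].
Proof.
move=> /projective_cover[P0 [e [fgP0 projP0 e_surj e_ess]]].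
have [i_inj ie _] := short_exact_ker e_surj.
have := fin_gen_ker L_noetherian e fgP0.
move=> /projective_cover[P1 [c [fgP1 projP1 c_surj c_ess]]].
exists P1, P0, (incl (ker_submod e) \o c), e; do 2?split=> //.
  move=> y; rewrite ie; split=> [[k <-]|[x <-]]; last by exists (c x).
  by have [x <-] := c_surj k; exists x.
by move=> X g gd; apply: c_ess => a; have [x /i_inj] := gd a; exists x.
Qed.

Lemma essential_fin_gen U V (f : {linear U -> V}) :
  fin_gen V -> essential_onto_image f -> fin_gen U.
Proof.
move=> fgV f_ess; have noethV := noetherian_fin_gen L_noetherian fgV.
have [n [c c_surj]] :=
  fin_gen_cover (noetherian_submod (image_submod f) noethV).
have [f' [f'_surj f'P]] := image_corestriction f.
have [g gP] := projective_row c f'_surj.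
apply: (@fin_gen_surj _ _ _ g _ (@fin_gen_row L n)); apply: f_ess => a.
by have [x cx] := c_surj (f' a); exists x; rewrite -!f'P gP cx.
Qed.

End ProjectiveCovers.

(** * Totally reflexive modules *)

Section TotallyReflexive.
Variable L : pzRingType.
Hypothesis L_dcc : dcc L^o.
Hypothesis L_noetherian : noetherian L^o.
Hypothesis Lc_noetherian : noetherian (L^c)^o.
Implicit Types K M N P : lmodType L.

Definition totally_reflexive M :=
  [/\ fin_gen M, reflexive M, forall n, ext_all n M L^o
    & forall n, ext_all n (dual M) (L^c)^o].

Lemma fin_gen_dual_module M : fin_gen M -> fin_gen (dual M).
Proof.
move=> fgM; have [n [e e_surj]] := fin_gen_cover fgM.
have [_ ie _] := short_exact_ker e_surj.
have [inj _] := dual_left_exact e_surj ie.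
apply: fin_gen_mono Lc_noetherian _ _ _ inj _.
by apply: fin_gen_dual; [exact: fin_gen_row|exact: projective_row].
Qed.

Lemma gorenstein_projectiveP M :
  fin_gen M -> gorenstein_projective M <-> totally_reflexive M.
Proof.
move=> fgM; split=> [[extM [T [P1 [P0 [d [e [q [pres q_surj dq]]]]]] extT]]|].
  have [[projP1 projP0] e_surj de e_ess d_ess] := pres.
  have fgP0 := essential_fin_gen L_noetherian fgM e_ess.
  have fgP1 := essential_fin_gen L_noetherian fgP0 d_ess.
  have [n|reflM extM'] :=
      ext_transpose_dual fgP1 fgP0 projP1 projP0 e_surj de q_surj dq.
    exact: Ext_vanish_ext_all (extT n.+1 isT).
  split=> // n; exact: Ext_vanish_ext_all (extM n.+1 isT).
move=> [_ reflM extM extM'].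
split; first by case=> // n _; exact: ext_all_Ext_vanish.
have [P1 [P0 [d [e [fgP1 fgP0 pres]]]]] :=
  min_presentation L_dcc L_noetherian fgM.
have [[projP1 projP0] e_surj de _ _] := pres.
have [n [c c_surj]] := fin_gen_cover (fin_gen_ker L_noetherian d fgP1).
(* A third term continues the presentation. Since Ext^1(M, L) vanishes, the dual complex is exact at
   [dual P1], so the image of the dual of [d2] is a cokernel of the dual of [d], that is, a
   transpose of [M]. *)
pose d2 : {linear 'rV[L]_n -> P1} := incl (ker_submod d) \o c.
have [q [q_surj qP]] := image_corestriction (dual_lin d2).
have dd2 x : d (d2 x) = 0 := inclP (c x).
have dq : exact_at (dual_map d) q.
  move=> y; have -> : q y = 0 <-> dual_lin d2 y = 0.
    rewrite -qP; split=> [->|]; first exact: linear0.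
    by rewrite -[RHS](linear0 (incl (image_submod (dual_lin d2)))) => /incl_inj.
  split=> [yd2|[g <-]]; last first.
    by apply: dual_ext => x; rewrite -[LHS]/(g (d (d2 x))) dd2; exact: linear0.
  have ex_e := short_exact_ker e_surj.
  have inj := @incl_inj _ _ _ (ker_submod e).
  have [x|d' d'P] := @factor_mono _ _ _ _ _ d inj.
    by apply: (incl_surj (ker_submod e)); apply/de; exists x.
  have d'_surj : surj d'.
    move=> k; have [x xP] := (de _).1 (inclP k).
    by exists x; apply: inj; rewrite d'P.
  have [x d'x|y' y'P] :=
      @factor_epi _ _ _ _ d' (y : {linear P1 -> L^o}) d'_surj.
    have [k <-] : exists k, incl (ker_submod d) k = x.
      by apply: (incl_surj (ker_submod d)); rewrite /= -d'P d'x linear0.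
    have [z <-] := c_surj k.
    exact (congr1 (fun f : dual 'rV[L]_n => f z) yd2).
  have [y'' y''P] := extM 0%N _ _ _ _ ex_e projP0 y'.
  exists y''; apply: dual_ext => x.
  by rewrite -[LHS]/(y'' (d x)) -d'P [LHS]y''P y'P.
exists (submod (image_submod (dual_lin d2))); first by exists P1, P0, d, e, q.
have fgT := fin_gen_surj q_surj (fin_gen_dual fgP1 projP1).
case=> // k _; apply: ext_all_Ext_vanish => //.
apply: ext_some_all (stable_retract_refl _) _.
apply: (ext_dual_transpose fgP1 fgP0 projP1 projP0 e_surj de q_surj dq reflM).
by move=> m; apply: ext_all_some => //; exact: fin_gen_dual_module.
Qed.

Definition is_retract N M := exists (a : {linear N -> M}) (b : {linear M -> N}),
  cancel a b.

Lemma totally_reflexive_retract N M :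
  is_retract N M -> totally_reflexive M -> totally_reflexive N.
Proof.
move=> [a [b ab]] [fgM [tlM evM] extM extM'].
have b_surj : surj b by move=> x; exists (a x).
have fgN := fin_gen_surj b_surj fgM.
split=> //; first split=> [x x0|F].
- rewrite -[x]ab (tlM (a x)) ?linear0 // => f.
  exact: (x0 (dual_lin a f)).
- have [m mP] := evM (F \o dual_lin a); exists (b m) => f.
  rewrite -[RHS]/(dual_lin b f m) -mP /=; congr (F _).
  by apply: dual_ext => x; rewrite -[RHS]/(f (b (a x))) ab.
- by move=> n; apply: ext_all_stable (extM n) => //; exact: retract_stable ab.
- move=> n; apply: ext_all_stable (extM' n) => //.
    exact: fin_gen_dual_module.
  apply: (@retract_stable _ _ _ (dual_lin b) (dual_lin a)) => f.
  by apply: dual_ext => x; rewrite -[LHS]/(f (b (a x))) ab.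
Qed.

(** The dual sequence is again short exact because Ext^1(M, L) vanishes. It makes the dual of [M] a
    syzygy of the dual of [K]; the remaining Ext^1 of the dual of [K] vanishes by reflexivity of
    [M]. *)
Lemma totally_reflexive_syzygy K P M
    (i : {linear K -> P}) (e : {linear P -> M}) :
    short_exact i e -> fin_gen P -> projective P ->
  totally_reflexive M -> totally_reflexive K.
Proof.
move=> ie fgP projP [fgM [tlM evM] extM extM'].
have [i_inj ie_ex e_surj] := ie.
have [tlP evP] := reflexive_projective fgP projP.
have ie' := dual_short_exact ie (extM 0%N _ _ _ _ ie projP).
have projP' := projective_dual fgP projP.
split; first exact: fin_gen_mono L_noetherian _ _ _ i_inj _.
- split=> [x x0|F].
    apply: i_inj; rewrite linear0; apply: tlP => f.
    exact: (x0 (dual_lin i f)).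
  have [p pP] := evP (F \o dual_lin i).
  have [k kp] : exists k, i k = p.
    apply/ie_ex/tlM => f; rewrite -[LHS]/(dual_lin e f p) -pP.
    have [_ ex _] := ie'.
    have ief : dual_lin i (dual_lin e f) = 0 by apply/ex; exists f.
    exact (etrans (congr1 F ief) (linear0 F)).
  exists k => f; have [_ _ /(_ f)[g <-]] := ie'.
  by rewrite -[LHS]/((F \o dual_lin i) g) pP -kp.
- by move=> n; exact: ext_all_shift ie projP (extM n.+1).
- move=> n; apply: ext_some_all (stable_retract_refl _) _.
  case: n => [|n]; exists _, _, (dual_lin e), (dual_lin i); split=> //.
    move=> F; have [m mP] := evM F; have [p pm] := e_surj m.
    by exists (ev p) => f; rewrite mP -pm.
  by apply: ext_all_some => //; exact: fin_gen_dual_module.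
Qed.

End TotallyReflexive.

(** * CM-finite algebras *)

Section Decomposition.
Variable L : pzRingType.
Implicit Types A B M N V : lmodType L.

Lemma isomorphic_retract M N :
  isomorphic M N -> is_retract M N /\ is_retract N M.
Proof.
move=> [f [g fK gK]].
have f_surj : surj f by move=> y; exists (g y).
have [h [fh hf]] := bijective_linear (can_inj fK) f_surj.
by split; [exists f, h|exists h, f].
Qed.

Lemma is_retract_trans M N V :
  is_retract M N -> is_retract N V -> is_retract M V.
Proof.
move=> [a [b ab]] [a' [b' ab']].
by exists (a' \o a), (b \o b') => x /=; rewrite ab' ab.
Qed.

(** Induction over a decomposition into indecomposables, without constructing one: a minimal direct
    summand of [V] that violates [Q] would be neither zero nor indecomposable, and its two proper
    summands would satisfy [Q]. *)
Lemma decomposition_ind V (Q : lmodType L -> Prop) : dcc V ->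
    (forall M N, is_retract M N -> Q N -> Q M) ->
    (forall M, zero_module M -> Q M) ->
    (forall M N, Q M -> Q N -> Q (M * N)%type) ->
    (forall M, is_retract M V -> indecomposable M -> Q M) ->
  Q V.
Proof.
move=> dccV Q_ret Q0 QX Q_indec; apply: contrapT => nQV.
pose bad (A : set V) := exists A_sub : is_submod A,
  ~ Q (submod A_sub) /\
  exists p : {linear V -> submod A_sub}, cancel (incl A_sub) p.
have bad_image N (j : {linear N -> V}) (p : {linear V -> N}) :
    cancel j p -> ~ Q N -> bad [set v | exists x, j x = v]%classic.
  move=> jp nQN; exists (image_submod j).
  have [c [c_surj cP]] := image_corestriction j.
  have [|c' [cK c'K]] := bijective_linear _ c_surj.
    by move=> x y xy; apply: (can_inj jp); rewrite -!cP xy.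
  split; first by move=> Qim; apply: nQN; apply: Q_ret Qim; exists c, c'.
  exists (c \o p) => y; have [x <-] := c_surj y.
  by rewrite cP /= jp.
have [|A [_ [A_sub [nQX [p pK]]] A_min]] := dcc_minimal (Q := bad) dccV.
  exists [set v | exists x, (idfun : {linear V -> V}) x = v]%classic.
    exact: image_submod.
  exact: (bad_image V idfun idfun).
pose X : lmodType L := submod A_sub.
have Q_proper N (j : {linear N -> X}) (r : {linear X -> N}) :
    cancel j r -> ~ surj j -> Q N.
  move=> jr nj_surj; apply: contrapT => nQN.
  pose j' : {linear N -> V} := incl A_sub \o j.
  pose r' : {linear V -> N} := r \o p.
  have jr' : cancel j' r' by move=> x; rewrite /= pK jr.
  apply: nj_surj => y.
  have [_ [x <-]|x xy] :=
      A_min _ (image_submod j') (bad_image N j' r' jr' nQN) _ _ (inclP y).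
    exact: inclP.
  by exists x; exact: incl_inj xy.
have XV : is_retract X V by exists (incl A_sub), p.
apply: nQX; apply: contrapT => nQX.
have [X_indec|] := pselect (indecomposable X); first exact/nQX/Q_indec.
apply; split=> [X0|B C XBC]; first exact/nQX/Q0.
apply: contrapT => /not_orP[B_nz C_nz]; apply: nQX.
have [[f [g fK]] [g' [f' g'K]]] := isomorphic_retract XBC.
apply: (Q_ret X (B * C)%type) => //; first by exists f, g.
have inl_lin : linear (fun x : B => (x, 0 : C)).
  by move=> a x y; congr pair; rewrite /= scaler0 addr0.
have inr_lin : linear (fun x : C => (0 : B, x)).
  by move=> a x y; congr pair; rewrite /= scaler0 addr0.
have fst_lin : linear (fun x : B * C => x.1) by [].
have snd_lin : linear (fun x : B * C => x.2) by [].
apply: QX.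
- apply: (Q_proper B (g' \o linear_of inl_lin) (linear_of fst_lin \o f')).
    by move=> x; rewrite /= g'K.
  move=> g'_surj; apply: C_nz => x; have [y /=] := g'_surj (g' (0, x)).
  by move=> /(can_inj g'K)[].
- apply: (Q_proper C (g' \o linear_of inr_lin) (linear_of snd_lin \o f')).
    by move=> x; rewrite /= g'K.
  move=> g'_surj; apply: B_nz => x; have [y /=] := g'_surj (g' (x, 0)).
  by move=> /(can_inj g'K)[].
Qed.

End Decomposition.

Lemma projective_Ext_vanish (S : pzRingType) (M N : lmodType S) i :
  projective M -> (1 <= i)%N -> Ext_vanish i M N.
Proof.
move=> projM; case: i => // i _.
(* A projective module resolves itself, with zero modules in positive degrees. *)
pose F n : lmodType S := if n is 0 then M else 'rV[S]_0.
have proj_F n : projective (F n) by case: n => //= n; exact: projective_row.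
have F0 n (x : F n.+1) : x = 0 by exact: thinmx0.
exists (@ProjResolution S M F (fun n => \0 : {linear F n.+1 -> F n})
  (idfun : {linear M -> M}) proj_F (fun y => ex_intro _ y erefl)
  (fun y => conj (fun y0 => ex_intro _ 0 (esym y0))
     (fun x => let: ex_intro _ x0 := x in esym x0))
  (fun n y => conj (fun _ => ex_intro _ 0 (esym (F0 n y))) (fun _ => erefl))).
move=> f _; exists (\0 : {linear F i -> N}) => x.
by rewrite (F0 i x) !linear0.
Qed.

Section CMFinite.
Variable L : pzRingType.
Hypothesis L_dcc : dcc L^o.
Hypothesis L_noetherian : noetherian L^o.
Hypothesis Lc_noetherian : noetherian (L^c)^o.
Hypothesis L_CM_finite : CM_finite L.

Lemma pigeonhole_nat (T : finType) (f : nat -> T) :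
  exists m n, (m < n)%N /\ f m = f n.
Proof.
apply: contrapT => f_inj.
have /leq_card : injective (fun i : 'I_#|T|.+1 => f i).
  move=> i j fij; apply/val_inj/eqP; apply: contrapT => /negP.
  by rewrite neq_ltn => /orP[] lt_ij; apply: f_inj;
    [exists i, j|exists j, i].
by rewrite card_ord ltnn.
Qed.

Lemma self_orthogonal_projective (M : lmodType L) :
  totally_reflexive M -> (forall n, ext_all n M M) -> projective M.
Proof.
move=> trM extMM.
have step (X : {M : lmodType L | totally_reflexive M}) :
    exists Y : {M : lmodType L | totally_reflexive M},
    exists (P : lmodType L)
      (i : {linear sval Y -> P}) (e : {linear P -> sval X}),
      [/\ short_exact i e, fin_gen P & projective P].
  case: X => X trX; have [fgX _ _ _] := trX.
  have [n [e e_surj]] := fin_gen_cover fgX.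
  have ie := short_exact_ker e_surj.
  have trK := totally_reflexive_syzygy L_noetherian Lc_noetherian ie
    (@fin_gen_row L n) (@projective_row L n) trX.
  exists (exist (fun M => totally_reflexive M) _ trK), 'rV[L]_n.
  exists (incl (ker_submod e)), e; split=> //.
    exact: fin_gen_row.
  exact: projective_row.
have [f fP] := fun_of_rel step.
pose Z n := iter n f (exist (fun M => totally_reflexive M) M trM).
have trZ n : totally_reflexive (sval (Z n)) := svalP (Z n).
have fgZ n : fin_gen (sval (Z n)) by case: (trZ n).
have ext_proj n (P : lmodType L) : fin_gen P -> projective P ->
    forall k, ext_all k (sval (Z n)) P.
  move=> fgP projP k; apply: ext_all_fin_gen_projective => //.
  by case: (trZ n).
(* Self-orthogonality passes to the syzygy: the connecting map raises the degree when the second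
   argument is replaced, and the shift in the first argument lowers it again. *)
have ext_self n k : ext_all k (sval (Z n)) (sval (Z n)).
  elim: n k => [//|n IHn] k; have [P [i [e [ie fgP projP]]]] := fP (Z n).
  apply: (ext_all_shift ie projP); apply: (ext_all_connecting ie) => //.
  exact: ext_proj.
have ext_le m n k : (m <= n)%N -> ext_all k (sval (Z n)) (sval (Z m)).
  move=> /subnK <-; elim: (n - m)%N k => [//|d IHd] k.
  have [P [i [e [ie _ projP]]]] := fP (Z (d + m)%N).
  exact: ext_all_shift ie projP (IHd k.+1).
have proj_down n : projective (sval (Z n.+1)) -> projective (sval (Z n)).
  move=> projZ; have [P [i [e [ie fgP projP]]]] := fP (Z n).
  exact (ext_split ie projP (ext_proj n _ (fgZ n.+1) projZ 0%N)).
have [r [G GP]] := L_CM_finite.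
(* Only finitely many sets of indices exist, so two distinct syzygies have the same members of the
   list [G] as direct summands. *)
pose s n := [set j : 'I_r | `[< is_retract (G j) (sval (Z n)) >]].
have [m [n [lt_mn s_eq]]] := pigeonhole_nat s.
suff projZ : projective (sval (Z n.-1)).
  by elim: {lt_mn s_eq} n.-1 projZ => // d IHd /proj_down.
case: n lt_mn s_eq => // n lt_mn s_eq.
have [P [i [e [ie fgP projP]]]] := fP (Z n).
apply: (ext_split ie projP).
(* An indecomposable summand of [Z n.+1] is isomorphic to some [G j], hence is a summand of [Z m],
   and [m <= n] makes Ext^1 from [Z n] to it vanish. *)
apply: (decomposition_ind (V := sval (Z n.+1)) (Q := ext_all 0 (sval (Z n)))).
- exact: dcc_fin_gen.
- by move=> A B [a [b ab]] extB; exact (ext_all_retract ab extB).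
- by move=> A A0; exact: (@ext_all_zero _ 0 (sval (Z n)) A A0).
- by move=> A B extA extB; exact (@ext_all_prod _ 0 _ A B extA extB).
- move=> X XZ X_indec.
  have trX :=
    totally_reflexive_retract L_noetherian Lc_noetherian XZ (trZ n.+1).
  have [fgX _ _ _] := trX.
  have [|j XG] := GP X fgX X_indec.
    exact/(gorenstein_projectiveP L_dcc L_noetherian Lc_noetherian).
  have [XGj GjX] := isomorphic_retract XG.
  have : j \in s n.+1 by rewrite inE; apply/asboolP; exact: is_retract_trans XZ.
  rewrite -s_eq inE => /asboolP /(is_retract_trans XGj)[a [b ab]].
  by apply: ext_all_retract ab _; exact: ext_le.
Qed.

End CMFinite.

Theorem theorem3p6 (R : comNzRingType) (L : algType R) :
  artin_algebra L -> CM_finite L ->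
  forall M : lmodType L, fin_gen M -> gorenstein_projective M ->
    (projective M <-> forall i : nat, (1 <= i)%N -> Ext_vanish i M M).
Proof.
move=> L_artin L_CM M fgM gpM; split=> [projM i|extMM].
  exact: projective_Ext_vanish.
have dccL := artin_dcc L_artin.
have noethL := artin_noetherian L_artin.
have noethLc := artin_noetherian_converse L_artin.
apply: (self_orthogonal_projective dccL noethL noethLc L_CM).
  exact/gorenstein_projectiveP.
by move=> n; apply: Ext_vanish_ext_all; exact: extMM.
Qed.
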